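(* A graph $G$ is double-$\mathrm{col}$-critical with $\mathrm{col}(G)=5$ if and only if $G$ is isomorphic to $Q_1$, $Q_2$, $Q_3$, or to the square $C_n^2$ of a cycle $C_n$ of length $n\ge 5$.
   Context: All graphs are finite and simple. The colouring number $\mathrm{col}(G)$ of a non-empty graph $G$ is the smallest integer $k$ for which there is an ordering of the vertices of $G$ such that, when removing the vertices in this order, no vertex of degree more than $k-1$ in the remaining graph is removed at any step; equivalently $\mathrm{col}(G)=\max\{\delta(H) : H \text{ is a (non-empty) induced subgraph of } G\}+1$. The empty graph $K_0$ has colouring number $0$. For an edge $e=xy$ let $V(e)=\{x,y\}$. An edge $e$ of $G$ is double-$\mathrm{col}$-critical if $\mathrm{col}(G-V(e))\le \mathrm{col}(G)-2$. A graph $G$ is double-$\mathrm{col}$-critical if it is connected and each of its edges is double-$\mathrm{col}$-critical. The square $G^2$ of a graph $G$ is obtained from $G$ by adding an edge between every pair of vertices at distance $2$ in $G$. Let $K_5^{\triangledown}$ be the graph obtained from $K_5$ by deleting the three edges of a triangle, and let $K_{2,2,2}^{\triangledown}$ be the graph obtained from the octahedron $K_{2,2,2}$ by deleting the three edges of a triangle. Each of these two graphs has exactly three vertices of degree $2$ (pairwise non-adjacent), all other vertices having degree $4$. The graphs $Q_1,Q_2,Q_3$ are the three graphs (up to isomorphism) obtained as the union of two graphs $A$ and $B$, each isomorphic to $K_5^{\triangledown}$ or $K_{2,2,2}^{\triangledown}$, such that $V(A)\cap V(B)$ is exactly the set of the three degree-$2$ vertices of $A$ and also exactly the set of the three degree-$2$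 vertices of $B$. Explicitly, they are: the $7$-vertex graph with vertices $a_1,a_2,a_3,x_1,x_2,y_1,y_2$ and edges $x_1x_2$, $y_1y_2$, and $a_ix_j$, $a_iy_j$ for all $i\in\{1,2,3\}$, $j\in\{1,2\}$; the $9$-vertex graph with vertices $a_i,x_i,y_i$ ($i\in\{1,2,3\}$) and edges $x_ix_j$, $y_iy_j$ for $i<j$, and $a_ix_j$, $a_iy_j$ for all $i\ne j$; the $8$-vertex graph with vertices $a_1,a_2,a_3,x_1,x_2,y_1,y_2,y_3$ and edges $x_1x_2$, $a_ix_j$ for all $i\in\{1,2,3\}$, $j\in\{1,2\}$, $y_iy_j$ for $i<j$, and $a_iy_j$ for all $i\neq j$. *)

(* Defs.v *)
From mathcomp Require Import all_boot.

Set Implicit Arguments.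
Unset Strict Implicit.
Unset Printing Implicit Defensive.

Record sgraph := SGraph {
  svertex :> finType;
  sedge : rel svertex;
  sedge_sym : symmetric sedge;
  sedge_irrefl : irreflexive sedge }.

Arguments sedge {s} : rename.

Definition iso (G H : sgraph) : Prop :=
  exists2 f : G -> H, bijective f & forall x y, sedge (f x) (f y) = sedge x y.

(* The empty graph counts as connected here. *)
Definition connected (G : sgraph) : Prop :=
  forall x y : G, connect sedge x y.

Section Induced.

Variables (G : sgraph) (S : {set G}).

Definition induced_edge : rel {x : G | x \in S} :=
  fun x y => sedge (val x) (val y).

Fact induced_edge_sym : symmetric induced_edge.
Proof. by move=> x y; apply: sedge_sym. Qed.

Fact induced_edge_irrefl : irreflexive induced_edge.
Proof. by move=> x; apply: sedge_irrefl. Qed.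

Definition induced : sgraph := SGraph induced_edge_sym induced_edge_irrefl.

End Induced.

(* The vertices of s are removed from left to right: when x is removed, its
   degree in the remaining graph is its number of neighbours further right. *)
Fixpoint removal_ok (G : sgraph) (k : nat) (s : seq G) : bool :=
  if s is x :: s' then (count (sedge x) s' < k) && removal_ok k s' else true.

Definition has_removal_order (G : sgraph) (k : nat) : bool :=
  has (removal_ok k) (permutations (enum G)).

Fact has_removal_order_ex (G : sgraph) : exists k, has_removal_order G k.
Proof.
exists #|G|; apply/hasP; exists (enum G).
  by rewrite mem_permutations.
have: size (enum G) <= #|G| by rewrite -cardE.
elim: (enum G) => //= x s IHs lt_s.
rewrite (leq_ltn_trans (count_size _ _) lt_s) /=.
exact/IHs/ltnW.
Qed.

(* "Degree at most k - 1" is rendered as "degree < k", so that k = 0 is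
   feasible exactly for the graph without vertices, whose colouring number
   is thus 0. *)
Definition col (G : sgraph) : nat := ex_minn (has_removal_order_ex G).

Definition del_edge_ends (G : sgraph) (x y : G) : sgraph :=
  induced (~: [set x; y]).

(* col (G - V(e)) <= col G - 2, without truncated subtraction. *)
Definition double_col_critical_edge (G : sgraph) (x y : G) : Prop :=
  col (del_edge_ends x y) + 2 <= col G.

Definition double_col_critical (G : sgraph) : Prop :=
  connected G /\
  forall x y : G, sedge x y -> double_col_critical_edge x y.

Section Square.

Variable G : sgraph.

Definition walk (n : nat) (x y : G) : bool :=
  [exists p : n.-tuple G, path sedge x p && (last x p == y)].

Definition at_distance (n : nat) (x y : G) : bool :=
  walk n x y && [forall m : 'I_n, ~~ walk m x y].

Definition square_edge : rel G :=
  fun x y => sedge x y || at_distance 2 x y.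

Fact walk_sym n : symmetric (walk n).
Proof.
suff sub x y : walk n x y -> walk n y x by move=> x y; apply/idP/idP; apply: sub.
case/existsP=> p /andP[xp /eqP <-].
have sz : size (rev (belast x p)) == n by rewrite size_rev size_belast size_tuple.
apply/existsP; exists (Tuple sz) => /=.
rewrite rev_path (eq_path (e' := sedge)) ?xp /=; last first.
  by move=> u v; apply: sedge_sym.
by case: (tval p) => //= z q; rewrite rev_cons last_rcons.
Qed.

Fact square_edge_sym : symmetric square_edge.
Proof.
move=> x y; rewrite /square_edge /at_distance sedge_sym walk_sym.
by congr (_ || (_ && _)); apply: eq_forallb => m; rewrite walk_sym.
Qed.

Fact square_edge_irrefl : irreflexive square_edge.
Proof.
move=> x; rewrite /square_edge sedge_irrefl /=.
apply/negP=> /andP[_ /forallP/(_ ord0)/negP[]].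
by apply/existsP; exists [tuple] => /=.
Qed.

Definition square : sgraph := SGraph square_edge_sym square_edge_irrefl.

End Square.

Section CycleGraph.

Variable n : nat.

(* ordS is the successor modulo n; the test i != j only matters for n = 1. *)
Definition cycle_edge : rel 'I_n :=
  fun i j => (i != j) && ((ordS i == j) || (ordS j == i)).

Fact cycle_edge_sym : symmetric cycle_edge.
Proof. by move=> i j; rewrite /cycle_edge eq_sym orbC. Qed.

Fact cycle_edge_irrefl : irreflexive cycle_edge.
Proof. by move=> i; rewrite /cycle_edge eqxx. Qed.

Definition cycle_graph : sgraph := SGraph cycle_edge_sym cycle_edge_irrefl.

End CycleGraph.

(* In Q1, Q2, Q3 the vertices a_i, x_i, y_i are inl i, inr (inl i) and
   inr (inr i), with indices starting from 0. *)
Definition Q1_edge : rel ('I_3 + ('I_2 + 'I_2)) := fun u v =>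
  match u, v with
  | inr (inl i), inr (inl j) | inr (inr i), inr (inr j) => i != j
  | inl _, inr _ | inr _, inl _ => true
  | _, _ => false
  end.

Definition Q2_edge : rel ('I_3 + ('I_3 + 'I_3)) := fun u v =>
  match u, v with
  | inr (inl i), inr (inl j) | inr (inr i), inr (inr j) => i != j
  | inl i, inr (inl j) | inr (inl i), inl j => i != j
  | inl i, inr (inr j) | inr (inr i), inl j => i != j
  | _, _ => false
  end.

Definition Q3_edge : rel ('I_3 + ('I_2 + 'I_3)) := fun u v =>
  match u, v with
  | inr (inl i), inr (inl j) => i != j
  | inr (inr i), inr (inr j) => i != j
  | inl _, inr (inl _) | inr (inl _), inl _ => true
  | inl i, inr (inr j) | inr (inr i), inl j => i != j
  | _, _ => false
  end.

Fact Q1_edge_sym : symmetric Q1_edge.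
Proof. by move=> [i|[i|i]] [j|[j|j]] //=; rewrite eq_sym. Qed.
Fact Q1_edge_irrefl : irreflexive Q1_edge.
Proof. by move=> [i|[i|i]] //=; rewrite eqxx. Qed.
Definition Q1 : sgraph := SGraph Q1_edge_sym Q1_edge_irrefl.

Fact Q2_edge_sym : symmetric Q2_edge.
Proof. by move=> [i|[i|i]] [j|[j|j]] //=; rewrite eq_sym. Qed.
Fact Q2_edge_irrefl : irreflexive Q2_edge.
Proof. by move=> [i|[i|i]] //=; rewrite eqxx. Qed.
Definition Q2 : sgraph := SGraph Q2_edge_sym Q2_edge_irrefl.

Fact Q3_edge_sym : symmetric Q3_edge.
Proof. by move=> [i|[i|i]] [j|[j|j]] //=; rewrite eq_sym. Qed.
Fact Q3_edge_irrefl : irreflexive Q3_edge.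
Proof. by move=> [i|[i|i]] //=; rewrite eqxx. Qed.
Definition Q3 : sgraph := SGraph Q3_edge_sym Q3_edge_irrefl.

(* Main.v *)
Require Import Defs.
From mathcomp Require Import all_boot zify.
From Stdlib Require Import Classical_Prop.

(** Call a graph spreading if an infection that starts at the ends of any edge,
    and passes to every vertex with two infected neighbours, reaches all vertices.
    The double-critical graphs with colouring number 5 turn out to be the nonempty
    4-regular spreading graphs, and it is these that are classified.

    If [G] is double-critical with colouring number 5, then a subgraph of minimum
    degree 4 must be all of [G] ([critical_min_degree]), and comparing the bound
    of [2 * m - 3] edges for 2-degenerate graphs with the minimum degree shows
    that [G] is 4-regular ([critical_quartic]). For a 4-regular graph,
    2-degeneracy of [G - x - y] says that the infection started at [x] and [y]
    spreads. The converse ([critical_of_spreading]) reads the same equivalence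
    backwards, so for the graphs listed it suffices to check 4-regularity
    and spreading: by evaluation for Q1, Q2, Q3 and by hand for squares of cycles.

    For the classification, the edge count is exact: an infected set that leaves
    out more than two vertices has exactly [2 * m - 3] edges, so no further vertex
    has three neighbours in it ([tight_third]). Moreover every triangle shares an
    edge with another one ([triangle_spreads]), so there are two adjacent
    vertices [p], [q] with two common neighbours. Assume at least six vertices.

    Either some such configuration grows into K5 or the octahedron minus a
    triangle, meeting the rest of the graph only in the three ports where the
    triangle is missing ([k5_capped], [octa_capped]). The infection leaves this
    piece through two of the ports, and tightness forces the outside to be again
    one of these two pieces ([cap_far_side]); this gives Q1, Q2 and Q3.

    Or no such piece exists, and then the configuration extends to a squared
    path, which can be prolonged until it closes up ([sqpath_extend],
    [max_sqpath_closes]); this gives the square of a cycle. In each case an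
    injective homomorphism into [G] is enough, since it must be an isomorphism
    ([iso_of_injective_hom]). *)

Set Implicit Arguments.
Unset Strict Implicit.
Unset Printing Implicit Defensive.

(** * Colouring number and degeneracy *)

Section Degrees.
Variable G : sgraph.
Implicit Types (S T : {set G}) (x y z : G).

Definition deg S x := #|[set y in S | sedge x y]|.

(** The subgraph induced by [T] has colouring number at most [k] exactly when
    every nonempty subgraph induced inside [T] has minimum degree below [k]. This
    ordering-free form is the one that passes to subsets and complements. *)
Definition degenerate k T :=
  forall S, S \subset T -> S != set0 -> exists2 x, x \in S & deg S x < k.

Lemma deg_sub S T x : S \subset T -> deg S x <= deg T x.
Proof.
move=> sST; apply: subset_leq_card; apply/subsetP=> y.
by rewrite !inE => /andP[/(subsetP sST)-> ->].
Qed.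

Lemma degU S T x : [disjoint S & T] -> deg (S :|: T) x = deg S x + deg T x.
Proof.
move=> dST; rewrite -[RHS]cardsUI.
have -> : [set y in S | sedge x y] :&: [set y in T | sedge x y] = set0.
  apply/setP=> y; rewrite !inE; case yS: (y \in S) => //=.
  by rewrite (disjointFr dST yS) andbF.
rewrite cards0 addn0; congr #|pred_of_set _|.
by apply/setP=> y; rewrite !inE andb_orl.
Qed.

Lemma degC S x : deg setT x = deg S x + deg (~: S) x.
Proof. by rewrite -degU ?setUCr // -setI_eq0 setICr. Qed.

Lemma deg_count s x : uniq s -> count (sedge x) s = deg [set:: s] x.
Proof.
move=> us; rewrite -size_filter -(card_uniqP (filter_uniq _ us)) /deg.
by apply: eq_card => y; rewrite !inE mem_filter andbC.
Qed.

Lemma deg_gt0P S x : reflect (exists2 y, y \in S & sedge x y) (0 < deg S x).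
Proof.
apply: (iffP card_gt0P) => [[y]|[y yS xy]].
  by rewrite !inE => /andP[]; exists y.
by exists y; rewrite inE yS.
Qed.

Lemma deg_gt1P S x :
  reflect (exists u v, [/\ u \in S, v \in S, u != v, sedge x u & sedge x v])
          (1 < deg S x).
Proof.
apply: (iffP card_gt1P) => [[u [v []]]|[u [v [uS vS uv xu xv]]]].
  by rewrite !inE => /andP[? ?] /andP[? ?] ?; exists u, v.
by exists u, v; split; rewrite ?inE ?uS ?vS.
Qed.

(** The first vertex of [S] to be removed still sees all of [S]. *)
Lemma removal_ok_degenerate k (s : seq G) S :
  removal_ok k s -> {subset S <= s} -> S != set0 ->
  exists2 x, x \in S & deg S x < k.
Proof.
elim: s => [_ sS /set0Pn[x /sS] //|x s IHs /= /andP[lt_k ok_s] sS nS].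
have [xS|xNS] := boolP (x \in S); last first.
  apply: IHs => // y yS; have /[!inE]/orP[/eqP yx|//] := sS y yS.
  by rewrite -yx yS in xNS.
exists x => //; apply: leq_ltn_trans lt_k.
rewrite -size_filter; apply: leq_trans (card_size _); apply: subset_leq_card.
apply/subsetP=> y; rewrite inE mem_filter => /andP[/sS + xy].
by rewrite inE xy => /predU1P[yx|//]; rewrite yx sedge_irrefl in xy.
Qed.

(** Greedy removal: [T] keeps its property after the loss of any vertex. *)
Lemma degenerate_removal_ok k T :
  degenerate k T -> exists s, [/\ uniq s, s =i T & removal_ok k s].
Proof.
have [n] := ubnP #|T|; elim: n T => // n IHn T le_n degT.
have [->|nT] := eqVneq T set0; first by exists [::]; split=> // x; rewrite inE.
have [x xT ltk] := degT T (subxx _) nT.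
have [||s [us sT oks]] := IHn (T :\ x).
- by rewrite (cardsD1 x) xT in le_n.
- by move=> S /subset_trans sS; apply: degT; apply/sS/subD1set.
have xNs : x \notin s by rewrite sT !inE eqxx.
exists (x :: s); split=> /=; first by rewrite xNs.
  by move=> y; rewrite inE sT !inE; case: eqP => // ->.
rewrite oks andbT deg_count //; apply: leq_ltn_trans ltk.
by apply: deg_sub; apply/subsetP=> y; rewrite inE sT !inE => /andP[].
Qed.

Lemma col_le_degenerate k : col G <= k <-> degenerate k [set: G].
Proof.
rewrite /col; case: ex_minnP => m /hasP[s sG oks] min_m; split.
  move=> le_mk S _ nS.
  have [|x xS lt_m] := removal_ok_degenerate oks _ nS.
    by move=> x _; rewrite mem_permutations in sG; rewrite (perm_mem sG) mem_enum.
  by exists x => //; apply: leq_trans le_mk.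
case/degenerate_removal_ok=> t [ut tG okt]; apply: min_m; apply/hasP; exists t => //.
rewrite mem_permutations uniq_perm ?enum_uniq // => x.
by rewrite tG mem_enum !inE.
Qed.

End Degrees.

Lemma col_induced_le (G : sgraph) (T : {set G}) k :
  col (induced T) <= k <-> degenerate k T.
Proof.
have deg_val (S : {set induced T}) x : deg S x = deg (val @: S) (val x).
  rewrite /deg -(card_imset _ val_inj); apply: eq_card => y; rewrite !inE.
  apply/imsetP/andP=> [[z]|[/imsetP[z zS ->] xz]]; last by exists z; rewrite ?inE ?zS.
  by rewrite inE => /andP[zS xz] ->; split; rewrite ?imset_f.
rewrite col_le_degenerate; split=> degT S.
  move=> sST nS; pose S' : {set induced T} := [set x | val x \in S].
  have eqS : val @: S' = S.
    apply/setP=> x; apply/imsetP/idP=> [[y + ->]|xS]; first by rewrite inE.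
    by exists (Sub x (subsetP sST x xS)); rewrite ?inE ?SubK.
  have [||x xS lt_k] := degT S'; first exact: subsetT.
    by apply: contraNneq nS; rewrite -eqS => ->; rewrite imset0.
  exists (val x); last by rewrite -eqS -deg_val.
  by rewrite inE in xS.
move=> _ nS; have [||y /imsetP[x xS ->] lt_k] := degT (val @: S).
- by apply/subsetP=> y /imsetP[x _ ->]; apply: valP.
- by rewrite imset_eq0.
by exists x; rewrite ?deg_val.
Qed.

(** * Counting edges *)

Section Counting.
Variable G : sgraph.
Implicit Types (S T : {set G}) (x y z : G).

(** Ordered adjacent pairs: [arcs S S] is twice the number of edges inside [S]. *)
Definition arcs S T := \sum_(x in S) deg T x.

Lemma deg_sum S x : deg S x = \sum_(y in S) sedge x y.
Proof.
rewrite /deg -sum1_card big_mkcond [RHS]big_mkcond /=.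
by apply: eq_bigr => y _; rewrite inE; case: (y \in S) (sedge x y) => [] [].
Qed.

Lemma arcsC S T : arcs S T = arcs T S.
Proof.
rewrite /arcs; under eq_bigr do rewrite deg_sum; rewrite exchange_big /=.
by apply: eq_bigr => y _; rewrite deg_sum; apply: eq_bigr => x _; rewrite sedge_sym.
Qed.

Lemma arcs_add_vertex S z : z \notin S ->
  arcs (z |: S) (z |: S) = arcs S S + (deg S z).*2.
Proof.
move=> zNS; have dz : [disjoint [set z] & S] by rewrite disjoints1.
have deg1 x : deg [set z] x = sedge x z by rewrite deg_sum big_set1.
rewrite /arcs big_setU1 //= degU // deg1 sedge_irrefl add0n.
under eq_bigr do rewrite degU // deg1; rewrite big_split /= addnA addnC -addnn.
by congr (_ + (_ + _)); rewrite deg_sum; apply: eq_bigr => x _; rewrite sedge_sym.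
Qed.

Lemma arcs_setC S : \sum_(x in S) deg setT x = arcs S S + arcs S (~: S).
Proof. by rewrite -big_split; apply: eq_bigr => x _; apply: degC. Qed.

(** A 2-degenerate graph on [m >= 2] vertices has at most [2 * m - 3] edges: the
    last two vertices span at most one edge, and each earlier removal destroys at
    most two. *)
Lemma degenerate_arcs T : degenerate 3 T -> 2 <= #|T| ->
  arcs T T + 6 <= 4 * #|T|.
Proof.
have [n] := ubnP #|T|; elim: n T => // n IHn T le_n degT gt1.
have nT : T != set0 by rewrite -card_gt0 ltnW.
have [x xT lt3] := degT T (subxx _) nT.
have xNT : x \notin T :\ x by rewrite !inE eqxx.
have cT : #|T| = (#|T :\ x|).+1 by rewrite (cardsD1 x) xT.
have lt3' : deg (T :\ x) x < 3 by apply: leq_ltn_trans lt3; apply/deg_sub/subD1set.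
have eqT := arcs_add_vertex xNT; rewrite setD1K // in eqT.
have [gt2|le2] := ltnP 1 #|T :\ x|.
  have : arcs (T :\ x) (T :\ x) + 6 <= 4 * #|T :\ x|.
    apply: IHn => //; first by lia.
    by move=> S /subset_trans sS; apply: degT; apply/sS/subD1set.
  by rewrite eqT cT -addnn; lia.
have /cards1P[y eqy] : #|T :\ x| == 1 by lia.
have ayy : arcs [set y] [set y] = 0.
  by rewrite /arcs big_set1 deg_sum big_set1 sedge_irrefl.
have dy1 : deg [set y] x <= 1 by rewrite deg_sum big_set1 leq_b1.
by rewrite eqT cT eqy ayy cards1 -addnn; lia.
Qed.

End Counting.

(** * From criticality to percolation *)

Definition quartic (G : sgraph) := forall x : G, deg setT x = 4.

(** Bootstrap percolation with threshold 2, started from any edge: [S] is the set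
    infected so far, and it grows as long as it is not everything. *)
Definition spreading (G : sgraph) := forall (S : {set G}) x y,
  x \in S -> y \in S -> sedge x y -> S != setT ->
  exists2 z, z \notin S & 2 <= deg S z.

Section Characterisation.
Variable G : sgraph.
Implicit Types (S T : {set G}) (x y z : G).

(** In a 4-regular graph a vertex has two neighbours in [S] iff it has at most two
    outside, so percolation from an edge is 2-degeneracy of what the edge leaves. *)
Lemma spreading_degenerate S x y : quartic G -> spreading G ->
  x \in S -> y \in S -> sedge x y -> degenerate 3 (~: S).
Proof.
move=> reg spr xS yS xy T sT nT.
have sTC u : u \in S -> u \in ~: T.
  by move=> uS; rewrite inE; apply: contraL uS => /(subsetP sT); rewrite inE.
have [|z] := spr (~: T) x y (sTC x xS) (sTC y yS) xy.
  by rewrite -setC0 (inj_eq (@setC_inj _)).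
rewrite inE negbK.
move=> zT; have := reg z; rewrite (degC T) => degz ge2.
by exists z => //; lia.
Qed.

(** The component of a vertex contains an edge but infects nothing outside itself. *)
Lemma spreading_connected : quartic G -> spreading G -> connected G.
Proof.
move=> reg spr x y.
have /deg_gt0P[z _ xz] : 0 < deg setT x by rewrite reg.
pose S := [set u | connect sedge x u].
have [eqS|nS] := eqVneq S setT; first by have := in_setT y; rewrite -eqS inE.
have xS : x \in S by rewrite inE connect0.
have zS : z \in S by rewrite inE connect1.
have [u uS] := spr S x z xS zS xz nS.
move=> /ltnW/deg_gt0P[v]; rewrite inE => xv uv; case/negP: uS.
by rewrite inE (connect_trans xv) // connect1 // sedge_sym.
Qed.

Lemma critical_of_spreading : 0 < #|G| -> quartic G -> spreading G ->
  double_col_critical G /\ col G = 5.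
Proof.
case/card_gt0P=> x0 _ reg spr.
have col5 : col G = 5.
  apply/anti_leq/andP; split.
    apply/col_le_degenerate=> S _ /set0Pn[x xS]; exists x => //.
    by rewrite ltnS -(reg x) deg_sub ?subsetT.
  rewrite ltnNge; apply/negP=> /col_le_degenerate/(_ setT)[||x _].
  - exact: subxx.
  - by apply/set0Pn; exists x0.
  by rewrite reg.
split=> //; split; first exact: spreading_connected.
move=> x y xy; rewrite /double_col_critical_edge col5 addn2 !ltnS.
apply/col_induced_le; apply: (spreading_degenerate reg spr _ _ xy).
  exact: set21.
exact: set22.
Qed.

Hypotheses (crit : double_col_critical G) (col5 : col G = 5).

Let degenerate_ends x y : sedge x y -> degenerate 3 (~: [set x; y]).
Proof.
move=> /(crit.2 x y); rewrite /double_col_critical_edge col5 addn2 !ltnS.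
by move/col_induced_le.
Qed.

(** Some induced subgraph [S] has minimum degree at least 4. If it were not all
    of [G], connectedness would give an edge [uw] leaving it; deleting [u] and [w]
    costs the vertices of [S] at most one neighbour each, so minimum degree 3
    would survive. *)
Lemma critical_min_degree x : 4 <= deg setT x.
Proof.
have [S nS degS] : exists2 S, S != set0 & forall x, x \in S -> 4 <= deg S x.
  have notdeg : ~ degenerate 4 [set: G] by move/col_le_degenerate; rewrite col5.
  have [S /andP[nS /forall_inP degS]|noS] :=
      pickP [pred S : {set G} | (S != set0) && [forall x in S, 4 <= deg S x]].
    by exists S.
  case: notdeg => S _ nS; have := noS S; rewrite /= nS /= => /negbT/forall_inPn[y yS].
  by rewrite -ltnNge; exists y.
suff eqS : S = setT by rewrite -eqS; apply: degS; rewrite eqS.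
apply/eqP; rewrite eqEsubset subsetT; apply/subsetP=> v _.
have [u uS] := set0Pn _ nS.
have /connectP[p + ->] := crit.1 u v.
elim: p u uS => //= w p IHp u uS /andP[uw] /IHp; apply.
apply/negPn/negP=> wNS.
have [||z] := degenerate_ends uw (S := S :\ u).
- apply/subsetP=> z; rewrite !inE => /andP[zu zS]; rewrite negb_or zu.
  by apply: contraNneq wNS => <-.
- have /deg_gt0P[z zS uz] := leq_trans (isT : 0 < 4) (degS u uS).
  apply/set0Pn; exists z; rewrite !inE zS andbT.
  by apply: contraTneq uz => ->; rewrite sedge_irrefl.
rewrite !inE => /andP[zu zS]; have := degS z zS.
rewrite -{1}(setD1K uS) degU ?disjoints1 ?setD11 //.
have : deg [set u] z <= 1 by rewrite deg_sum big_set1 leq_b1.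
by lia.
Qed.

(** A vertex [v] of degree 4 exists since [col G <= 5]. For an edge [vx], a vertex
    of degree at most 2 in [G - v - x] has degree at least 4 in [G], so it is a
    common neighbour [w] of [v] and [x] and has degree exactly 4. Now [G - v - w]
    is 2-degenerate, hence has at most [2 * (n - 2) - 3] edges; the seven edges at
    [v] or [w] bring the total to at most [2 * n], while minimum degree 4 needs
    that many. So all degrees are 4. *)
Lemma critical_quartic : quartic G.
Proof.
have [v degv] : exists v : G, deg setT v = 4.
  have /col_le_degenerate degG : col G <= 5 by rewrite col5.
  have [|v _ lt5] := degG setT (subxx _).
    apply/eqP=> G0; suff : col G <= 0 by rewrite col5.
    by apply/col_le_degenerate=> S; rewrite G0 subset0 => /eqP-> /eqP.
  by exists v; apply/anti_leq; rewrite critical_min_degree -ltnS lt5.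
have /deg_gt0P[x _ vx] : 0 < deg setT v by rewrite degv.
have cardC2 y z : y != z -> #|~: [set y; z]| + 2 = #|G|.
  by move=> yz; rewrite -(cardsC [set y; z]) cards2 yz addnC.
have adj_neq y z : sedge y z -> y != z.
  by apply: contraTneq => ->; rewrite sedge_irrefl.
have big_enough : 4 < #|G|.
  have : deg setT v <= #|[set~ v]|.
    apply: subset_leq_card; apply/subsetP=> y; rewrite !inE /=.
    by rewrite eq_sym => /adj_neq.
  by rewrite degv -(cardsC [set v]) cards1.
have [w vw degw] : exists2 w, sedge v w & deg setT w = 4.
  have [|w] := degenerate_ends vx (subxx _).
    by rewrite -card_gt0; have := cardC2 v x (adj_neq _ _ vx); lia.
  move=> _ lt3; have := critical_min_degree w; rewrite (degC [set v; x]) => ge4.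
  have : 1 < deg [set v; x] w by lia.
  have eq_deg : deg [set v; x] w = sedge w v + sedge w x.
    by rewrite deg_sum big_setU1 ?big_set1 // inE adj_neq.
  rewrite eq_deg => gt1; have wv : sedge w v.
    by move: gt1; case: (sedge w v) => //; case: sedge.
  exists w; first by rewrite sedge_sym.
  apply/anti_leq; rewrite critical_min_degree andbT (degC [set v; x]) eq_deg wv.
  by case: sedge; lia.
pose T := ~: [set v; w].
have nvw := adj_neq _ _ vw.
have cardT : #|T| + 2 = #|G| by apply: cardC2.
have le_arcs : arcs T T + 6 <= 4 * #|T|.
  by apply: degenerate_arcs; [apply: degenerate_ends | lia].
(* Each of [v] and [w] sends three of its four edges to [T]. *)
have cross : arcs T (~: T) = 6.
  rewrite arcsC /T setCK.
  have inner u : deg [set v; w] u = sedge u v + sedge u w.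
    by rewrite deg_sum big_setU1 ?big_set1 // inE.
  rewrite /arcs big_setU1 ?inE //= big_set1.
  have := degC [set v; w] v; have := degC [set v; w] w.
  by rewrite !inner degv degw !sedge_irrefl [sedge w v]sedge_sym vw; lia.
have le_sum : \sum_(y in T) deg setT y <= \sum_(y in T) 4.
  by rewrite arcs_setC cross sum_nat_const mulnC.
move=> u; have [uT|] := boolP (u \in T); last first.
  by rewrite !inE negbK => /orP[]/eqP->.
apply/anti_leq; rewrite critical_min_degree andbT.
move: le_sum; rewrite (bigD1 u) //= [leqRHS](bigD1 u) //= => le_sum.
rewrite leqNgt; apply/negP=> gt4; suff : false by [].
have : \sum_(i in T | i != u) 4 <= \sum_(i in T | i != u) deg setT i.
  by apply: leq_sum => i _; apply: critical_min_degree.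
by lia.
Qed.

Lemma critical_spreading : spreading G.
Proof.
move=> S x y xS yS xy nS.
have [||z] := degenerate_ends xy (S := ~: S).
- by rewrite setCS subUset !sub1set xS.
- by rewrite -setCT (inj_eq (@setC_inj _)).
rewrite inE => zS lt3; exists z => //.
by have := critical_quartic z; rewrite (degC S); lia.
Qed.

End Characterisation.

(** * Recognising a graph from a copy inside it *)

(** Both graphs are 4-regular, so an injective homomorphism is locally onto: its
    image is a union of components containing an edge, which percolation forces to
    be everything. Hence exhibiting a graph of the list inside [G] identifies [G]. *)
Lemma iso_of_injective_hom (G H : sgraph) (g : H -> G) :
    0 < #|H| -> quartic H -> quartic G -> spreading G ->
    injective g -> (forall x y, sedge x y -> sedge (g x) (g y)) ->
  iso G H.
Proof.
move=> /card_gt0P[h0 _] regH regG sprG inj_g hom_g.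
have nbr_g h : [set y in setT | sedge (g h) y] = g @: [set y in setT | sedge h y].
  apply/esym/eqP; rewrite eqEcard card_imset //.
  have := regG (g h); rewrite /deg => ->; have := regH h; rewrite /deg => ->.
  rewrite leqnn andbT.
  by apply/subsetP=> _ /imsetP[y + ->]; rewrite !inE => /hom_g.
have edge_g x y : sedge (g x) (g y) = sedge x y.
  apply/idP/idP=> [gxy|/hom_g //].
  have : g y \in [set z in setT | sedge (g x) z] by rewrite !inE.
  by rewrite nbr_g mem_imset // !inE.
have surj_g : g @: setT = setT.
  apply/eqP/negPn/negP=> nT.
  have /deg_gt0P[h1 _ h01] : 0 < deg setT h0 by rewrite regH.
  have [z /negP zg] := sprG _ _ _ (imset_f g (in_setT h0)) (imset_f g (in_setT h1))
    (hom_g _ _ h01) nT.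
  case/ltnW/deg_gt0P=> _ /imsetP[h _ ->]; rewrite sedge_sym => hz; case: zg.
  have : z \in [set y in setT | sedge (g h) y] by rewrite !inE.
  by rewrite nbr_g => /imsetP[y _ ->]; rewrite imset_f.
have bij_g : bijective g.
  by apply: inj_card_bij; rewrite // -[leqLHS]cardsT -surj_g card_imset ?cardsT.
have [f fK gK] := bij_g; exists f; first by exists g.
by move=> x y; rewrite -edge_g !gK.
Qed.

Lemma iso_transport (G H : sgraph) : iso G H ->
  0 < #|H| -> quartic H -> spreading H -> [/\ 0 < #|G|, quartic G & spreading G].
Proof.
case=> f bij_f edge_f H_gt0 regH sprH; have inj_f := bij_inj bij_f.
have [g fK gK] := bij_f.
have imC (S : {set G}) x : (f x \in f @: S) = (x \in S) by rewrite mem_imset.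
have deg_f (S : {set G}) x : deg (f @: S) (f x) = deg S x.
  rewrite /deg -[RHS](card_imset _ inj_f); apply: eq_card => y; rewrite -[y]gK.
  by rewrite inE imC edge_f imC inE.
have imT : f @: setT = setT.
  by apply/setP=> y; rewrite -[y]gK imC !inE.
split; first by rewrite (bij_eq_card bij_f).
  by move=> x; rewrite -deg_f imT.
move=> S x y xS yS; rewrite -edge_f => fxy nS.
have [|z] := sprH _ _ _ (imset_f f xS) (imset_f f yS) fxy.
  by rewrite -imT (inj_eq (imset_inj inj_f)).
by rewrite -[z]gK imC deg_f; exists (g z).
Qed.

(** The sets at which the percolation stops. *)
Definition absorbing (G : sgraph) (S : {set G}) := forall z u v,
  u \in S -> v \in S -> u != v -> sedge z u -> sedge z v -> z \in S.

Lemma absorbing_spreading (G : sgraph) :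
    (forall (S : {set G}) x y z, absorbing S ->
      x \in S -> y \in S -> sedge x y -> z \in S) ->
  spreading G.
Proof.
move=> absT S x y xS yS xy nS.
have [z /andP[zNS ge2]|none] := pickP [pred z | (z \notin S) && (1 < deg S z)].
  by exists z.
case/eqP: nS; apply/setP=> z; rewrite inE.
apply: absT xS yS xy => w u v uS vS uv wu wv; apply/negPn/negP=> wNS.
suff lt1 : 1 < deg S w by have := none w; rewrite /= wNS lt1.
by apply/deg_gt1P; exists u, v.
Qed.

(** * The three sporadic graphs *)

Section FiniteCheck.
Variables (H : sgraph) (es : seq H).
Hypotheses (uniq_es : uniq es) (mem_es : forall x, x \in es).

(** One round of percolation on explicit lists, so that the property can be
    decided by evaluation for the three sporadic graphs. *)
Definition grow s := [seq z <- es | (z \in s) || (1 < count (sedge z) s)].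

Definition exhausts (s : seq H) := all (fun z => z \in s) es.

Definition spreads :=
  all (fun x => all (fun y =>
    sedge x y ==> exhausts (iter (size es) grow [:: x; y])) es) es.

Lemma quartic_check : all (fun x => count (sedge x) es == 4) es -> quartic H.
Proof.
move=> /allP all4 x; have /eqP <- := all4 x (mem_es x); rewrite deg_count //.
by apply: eq_card => y; rewrite !inE mem_es.
Qed.

Lemma spreading_check : spreads -> spreading H.
Proof.
move=> chk; apply: absorbing_spreading => S x y z absS xS yS xy.
have {chk} : z \in iter (size es) grow [:: x; y].
  have /allP/(_ y (mem_es y)) := allP chk x (mem_es x).
  by rewrite xy => /allP; apply.
suff: uniq (iter (size es) grow [:: x; y]) /\ {subset iter (size es) grow [:: x; y] <= S}.
  by case=> _; apply.
elim: (size es) => [|n [us sS]] /=.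
  split; last by move=> u; rewrite !inE => /orP[]/eqP->.
  by rewrite inE andbT; apply: contraTneq xy => ->; rewrite sedge_irrefl.
split; first exact: filter_uniq.
move=> u; rewrite mem_filter => /andP[/orP[/sS //|] + _].
rewrite deg_count // => /deg_gt1P[a [b []]]; rewrite !inE.
by move=> /sS aS /sS bS ab ua ub; apply: absS ab ua ub.
Qed.

End FiniteCheck.

Definition I2 : seq 'I_2 := [:: Ordinal (isT : 0 < 2); Ordinal (isT : 1 < 2)].
Definition I3 : seq 'I_3 :=
  [:: Ordinal (isT : 0 < 3); Ordinal (isT : 1 < 3); Ordinal (isT : 2 < 3)].

Lemma mem_I2 i : i \in I2. Proof. by case: i => [[|[|]]]. Qed.
Lemma mem_I3 i : i \in I3. Proof. by case: i => [[|[|[|]]]]. Qed.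

Definition sum_enum (A B C : Type) (a : seq A) (b : seq B) (c : seq C) :
    seq (A + (B + C)) :=
  map inl a ++ map (inr \o inl) b ++ map (inr \o inr) c.

Lemma mem_sum_enum (A B C : eqType) (a : seq A) (b : seq B) (c : seq C) :
    (forall x, x \in a) -> (forall x, x \in b) -> (forall x, x \in c) ->
  forall x, x \in sum_enum a b c.
Proof.
move=> a_ b_ c_ [x|[x|x]]; rewrite !mem_cat.
- by rewrite (map_f inl).
- by rewrite (map_f (inr \o inl)) ?orbT.
- by rewrite (map_f (inr \o inr)) ?orbT.
Qed.

Definition Q1_enum : seq Q1 := sum_enum I3 I2 I2.
Definition Q2_enum : seq Q2 := sum_enum I3 I3 I3.
Definition Q3_enum : seq Q3 := sum_enum I3 I2 I3.

Lemma mem_Q1_enum x : x \in Q1_enum.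
Proof. exact: mem_sum_enum mem_I3 mem_I2 mem_I2 x. Qed.
Lemma mem_Q2_enum x : x \in Q2_enum.
Proof. exact: mem_sum_enum mem_I3 mem_I3 mem_I3 x. Qed.
Lemma mem_Q3_enum x : x \in Q3_enum.
Proof. exact: mem_sum_enum mem_I3 mem_I2 mem_I3 x. Qed.

Lemma Q1_quartic : quartic Q1.
Proof. by apply: (quartic_check _ mem_Q1_enum); vm_compute. Qed.
Lemma Q2_quartic : quartic Q2.
Proof. by apply: (quartic_check _ mem_Q2_enum); vm_compute. Qed.
Lemma Q3_quartic : quartic Q3.
Proof. by apply: (quartic_check _ mem_Q3_enum); vm_compute. Qed.
Lemma Q1_spreading : spreading Q1.
Proof. by apply: (spreading_check _ mem_Q1_enum); vm_compute. Qed.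
Lemma Q2_spreading : spreading Q2.
Proof. by apply: (spreading_check _ mem_Q2_enum); vm_compute. Qed.
Lemma Q3_spreading : spreading Q3.
Proof. by apply: (spreading_check _ mem_Q3_enum); vm_compute. Qed.

(** * Squares of cycles *)

(** Distance 2 means distinct, non-adjacent and joined by a walk of length 2. *)
Lemma square_edgeE (G : sgraph) (x y : G) :
  square_edge x y =
  (x != y) && (sedge x y || [exists z, sedge x z && sedge z y]).
Proof.
have walk0 (u v : G) : walk 0 u v = (u == v).
  apply/existsP/eqP=> [[p]|->]; last by exists [tuple]; rewrite /= eqxx.
  by rewrite tuple0 => /eqP.
have walk1 (u v : G) : walk 1 u v = sedge u v.
  apply/existsP/idP=> [[p]|uv].
    by case/tupleP: p => z p; rewrite tuple0 /= andbT => /andP[uz /eqP<-].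
  by exists [tuple v]; rewrite /= uv eqxx.
have walk2 (u v : G) : walk 2 u v = [exists z, sedge u z && sedge z v].
  apply/existsP/existsP=> [[p]|[z uzv]].
    case/tupleP: p => z p; case/tupleP: p => w p; rewrite tuple0 /= andbT.
    by case/andP=> uzw /eqP<-; exists z.
  by exists [tuple z; v]; rewrite /= andbT eqxx andbT.
rewrite /square_edge /at_distance walk2.
have -> : [forall m : 'I_2, ~~ walk m x y] = (x != y) && ~~ sedge x y.
  rewrite -walk0 -walk1; apply/forallP/andP=> [noW|[no0 no1] [[|[|]]]//].
  by rewrite (noW ord0) (noW (Ordinal (isT : 1 < 2))).
have [->|] /= := eqVneq x y; first by rewrite sedge_irrefl andbF.
by case: (sedge x y) => //=; rewrite andbT.
Qed.

Section SquareOfCycle.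
Variable n : nat.
Hypothesis n_ge5 : 5 <= n.
Local Notation Csq := (square (cycle_graph n)).
Implicit Types i j : 'I_n.

Lemma val_iter_ordS k i : val (iter k (@ordS n) i) = (i + k) %% n.
Proof.
elim: k => [|k IHk] /=; first by rewrite addn0 modn_small.
by rewrite IHk -[(_ %% _).+1]addn1 modnDml addn1 addnS.
Qed.

Lemma iter_ordS_neq k i : 0 < k < n -> (iter k (@ordS n) i == i) = false.
Proof.
case/andP=> k_gt0 lt_kn; apply/eqP=> /(congr1 val); rewrite val_iter_ordS /= => e.
have := divn_eq (i + k) n; rewrite e; case: (_ %/ n) => [|q]; first by lia.
by rewrite mulSn; lia.
Qed.

Lemma cycle_square_edge i j : sedge (i : Csq) j =
  [|| j == ordS i, i == ordS j, j == ordS (ordS i) | i == ordS (ordS j)].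
Proof.
have neq1 (k : 'I_n) : (ordS k == k) = false by apply: (@iter_ordS_neq 1 k); lia.
have neq2 (k : 'I_n) : (ordS (ordS k) == k) = false by apply: (@iter_ordS_neq 2 k); lia.
have cE (k l : 'I_n) : cycle_edge k l = (ordS k == l) || (ordS l == k).
  rewrite /cycle_edge; have [<-|//] := eqVneq; by rewrite neq1.
change (square_edge (i : cycle_graph n) j = 
  [|| j == ordS i, i == ordS j, j == ordS (ordS i) | i == ordS (ordS j)]).
rewrite square_edgeE /= cE.
have [<-|neq_ij] /= := eqVneq; first by rewrite !(eq_sym i) neq1 neq2.
rewrite [j == _]eq_sym [i == _]eq_sym -orbA; do 2!congr (_ || _).
rewrite [j == _]eq_sym [i == _]eq_sym.
apply/existsP/orP=> [[k]|[/eqP e|/eqP e]].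
- rewrite !cE => /andP[/orP[]/eqP ik /orP[]/eqP kj].
  + by left; rewrite ik kj.
  + by rewrite -kj in ik; rewrite (ordS_inj ik) eqxx in neq_ij.
  + by rewrite -ik kj eqxx in neq_ij.
  + by right; rewrite kj ik.
- by exists (ordS i); rewrite !cE e !eqxx.
by exists (ordS j); rewrite !cE e !eqxx !orbT.
Qed.

(** A common neighbour turns an edge of span 2 into one of span 1, and two
    consecutive vertices infect the next one. *)
Lemma cycle_square_spreading : spreading Csq.
Proof.
have edge1 i : sedge (i : Csq) (ordS i) by rewrite cycle_square_edge eqxx.
have edge2 i : sedge (i : Csq) (ordS (ordS i)).
  by rewrite cycle_square_edge eqxx !orbT.
apply: absorbing_spreading => S x y z absS xS yS xy.
have run i k : i \in S -> ordS i \in S -> iter k (@ordS n) i \in S.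
  move=> iS i1S; suff: iter k (@ordS n) i \in S /\ iter k.+1 (@ordS n) i \in S by case.
  elim: k => [//|k [kS k1S]]; split=> //=; apply: absS kS k1S _ _ _.
  - by rewrite eq_sym; apply/negbT/(@iter_ordS_neq 1 (iter k _ i)); lia.
  - by rewrite sedge_sym edge2.
  by rewrite sedge_sym edge1.
have full i : i \in S -> ordS i \in S -> z \in S.
  move=> iS i1S; suff -> : z = iter (z + n - i) (@ordS n) i by apply: run.
  apply/val_inj; rewrite val_iter_ordS; have := ltn_ord i.
  by move=> lt_in; rewrite subnKC ?modnDr ?modn_small //; lia.
have skip i : i \in S -> ordS (ordS i) \in S -> ordS i \in S.
  move=> iS i2S; apply: absS iS i2S _ _ _; last exact: edge1.
    by rewrite eq_sym; apply/negbT; apply: (@iter_ordS_neq 2 i); lia.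
  by rewrite sedge_sym edge1.
move: xy; rewrite cycle_square_edge => /or4P[] /eqP e; rewrite e in xS yS *.
- exact: full xS yS.
- exact: full yS xS.
- exact: full xS (skip _ xS yS).
- exact: full yS (skip _ yS xS).
Qed.

Lemma cycle_square_quartic : quartic Csq.
Proof.
have predK := @ord_predK n; have SK := @ordSK n.
move=> i; pose i_ k := iter k (@ordS n) (ord_pred (ord_pred i)).
(* The neighbours are counted from two steps before [i], which is itself
   [i_ 2], so that all of them are forward shifts of one vertex. *)
have eqN : [set j in setT | sedge (i : Csq) j] =i [:: i_ 0; i_ 1; i_ 3; i_ 4].
  move=> j; rewrite !inE cycle_square_edge /i_ /= !predK.
  by rewrite !(eq_sym i) !(can2_eq SK predK); do 4!case: (_ == _).
have neq_i k l : l < k <= 4 -> (i_ l == i_ k) = false.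
  case/andP=> lt_lk le4; rewrite eq_sym /i_ -(subnK (ltnW lt_lk)) iterD.
  by rewrite iter_ordS_neq; lia.
rewrite /deg (eq_card eqN) (card_uniqP _) //.
by move: i_ neq_i {eqN} => i_ neq_i; rewrite /= !inE !neq_i.
Qed.

End SquareOfCycle.

(** * Tight sets *)

Section Local.
Variable G : sgraph.
Hypotheses (regG : quartic G) (sprG : spreading G).
Implicit Types (x y z : G) (s t P : seq G).

Lemma edge_neq x y : sedge x y -> x != y.
Proof. by apply: contraTneq => ->; rewrite sedge_irrefl. Qed.

Lemma count_ge (a : pred G) s t :
  uniq t -> {subset t <= s} -> all a t -> size t <= count a s.
Proof.
move=> ut ts at_; rewrite -size_filter; apply: uniq_leq_size => // x xt.
by rewrite mem_filter ts // (allP at_).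
Qed.

Lemma size_nbrs x s : uniq s -> all (sedge x) s -> size s <= 4.
Proof.
move=> us xs; rewrite -(regG x) -(card_uniqP us); apply: subset_leq_card.
by apply/subsetP=> y /(allP xs) xy; rewrite !inE.
Qed.

Lemma nbrs_full x s y :
  uniq s -> all (sedge x) s -> size s = 4 -> sedge x y -> y \in s.
Proof.
move=> us xs s4 xy; apply/negPn/negP=> ys.
by have := @size_nbrs x (y :: s); rewrite /= ys us xy xs s4 => /(_ isT isT).
Qed.

Lemma nbrs_more x s : size s < 4 -> exists2 y, y \notin s & sedge x y.
Proof.
move=> lt4; have [y /andP[]|none] := pickP [pred y | (y \notin s) && sedge x y].
  by exists y.
suff: deg setT x <= size s by rewrite regG leqNgt lt4.
apply: leq_trans (card_size s); apply: subset_leq_card; apply/subsetP=> y.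
rewrite !inE /= => xy; have := none y; rewrite /= xy andbT.
by case: (y \in s).
Qed.

Lemma order_ge5 x : 5 <= #|G|.
Proof.
rewrite -(cardsC [set x]) cards1 ltnS -(regG x); apply: subset_leq_card.
by apply/subsetP=> y; rewrite !inE /= eq_sym => /edge_neq.
Qed.

Lemma spread_seq s x y : uniq s ->
    x \in s -> y \in s -> sedge x y -> size s < #|G| ->
  exists2 z, z \notin s & 1 < count (sedge z) s.
Proof.
move=> us xs ys xy lt_s.
have xS : x \in [set:: s] by rewrite inE.
have yS : y \in [set:: s] by rewrite inE.
have [|z] := sprG xS yS xy; last rewrite inE.
  apply: contraTneq lt_s => eqT; rewrite -leqNgt -cardsT -eqT.
  by rewrite cardsE card_size.
by move=> zs; rewrite -deg_count //; exists z.
Qed.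

Lemma edge_in_triangle x y : sedge x y -> exists2 z, sedge z x & sedge z y.
Proof.
move=> xy; have u2 : uniq [:: x; y] by rewrite /= inE edge_neq.
have y2 : y \in [:: x; y] by rewrite !inE eqxx orbT.
have lt2 : 2 < #|G| by apply: leq_trans (order_ge5 x).
have [z _] := spread_seq u2 (mem_head _ _) y2 xy lt2.
by rewrite /= addn0 => gt1; exists z; move: gt1; case: sedge => //; case: sedge.
Qed.

(** A triangle is an infected set that is not yet everything, so some outside
    vertex sees two of its corners: every triangle shares an edge with another. *)
Lemma triangle_spreads x y z : sedge x y -> sedge x z -> sedge y z ->
  exists2 w, w \notin [:: x; y; z] &
    [\/ sedge w x /\ sedge w y, sedge w x /\ sedge w z | sedge w y /\ sedge w z].
Proof.
move=> xy xz yz.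
have u3 : uniq [:: x; y; z] by rewrite /= !inE negb_or !edge_neq.
have y3 : y \in [:: x; y; z] by rewrite !inE eqxx orbT.
have lt3 : 3 < #|G| by apply: leq_trans (order_ge5 x).
have [w wN] := spread_seq u3 (mem_head _ _) y3 xy lt3.
rewrite /= addn0 => gt1; exists w => //; move: gt1.
case wx: (sedge w x); case wy: (sedge w y); case wz: (sedge w z) => // _;
  by [constructor 1 | constructor 2 | constructor 3].
Qed.

Definition inner_arcs s := arcs [set:: s] [set:: s].

Lemma inner_arcs_cons s z : uniq s -> z \notin s ->
  inner_arcs (z :: s) = inner_arcs s + (count (sedge z) s).*2.
Proof.
by move=> us zs; rewrite /inner_arcs set_cons arcs_add_vertex ?inE // deg_count.
Qed.

(** At least [2 * m - 3] edges on [m] vertices, which is the largest possible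
    number when at least two vertices are left out. Such lists arise from an
    edge by repeatedly adding vertices with two neighbours already present. *)
Definition tight s := [/\ uniq s, exists x y, [/\ x \in s, y \in s & sedge x y]
  & 4 * size s <= inner_arcs s + 6].

Lemma tight_cons s z : tight s -> z \notin s -> 1 < count (sedge z) s ->
  tight (z :: s).
Proof.
move=> [us [x [y [xs ys xy]]] le_s] zs ge2; split; first by rewrite /= zs.
  by exists x, y; rewrite !inE xs ys !orbT.
by rewrite inner_arcs_cons //= -addnn; lia.
Qed.

Lemma tight_edge x y : sedge x y -> tight [:: x; y].
Proof.
move=> xy; split; first by rewrite /= inE edge_neq.
  by exists x, y; rewrite !inE !eqxx orbT.
by rewrite inner_arcs_cons ?inE ?edge_neq //= xy -addnn; lia.
Qed.

(** Adding a vertex with three neighbours would give a set [S] with at least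
    [2 * #|S| - 2] edges, hence at most four edges leaving it. But the complement
    of [S] is 2-degenerate, and by 4-regularity at least six edges leave it as soon
    as it has two vertices. *)
Lemma tight_third s z : tight s -> z \notin s -> 2 < count (sedge z) s ->
  #|G| <= size s + 2.
Proof.
move=> [us [x [y [xs ys xy]]] le_s] zs ge3; rewrite leqNgt; apply/negP=> gtG.
pose S := [set:: z :: s].
have cS : #|S| = (size s).+1 by rewrite cardsE (card_uniqP _) //= zs.
have le_S : 4 * #|S| <= arcs S S + 4.
  by rewrite cS -[arcs S S]/(inner_arcs (z :: s)) inner_arcs_cons // -addnn; lia.
have cSC := cardsC S.
have : arcs (~: S) (~: S) + 6 <= 4 * #|~: S|.
  apply: degenerate_arcs; last by lia.
  by apply: (spreading_degenerate regG sprG (x := x) (y := y));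
    rewrite ?inE ?xs ?ys ?orbT.
have sum4 (T : {set G}) : \sum_(u in T) deg setT u = 4 * #|T|.
  rewrite (eq_bigr (fun=> 4)) => [|u _]; last exact: regG.
  by rewrite sum_nat_const mulnC.
have := arcs_setC S; have := arcs_setC (~: S); rewrite setCK !sum4 (arcsC (~: S) S).
by lia.
Qed.

End Local.

(** * Pieces with three ports *)

Lemma notin_neq (T : eqType) (s : seq T) x y : x \notin s -> y \in s -> x != y.
Proof. by move=> xs ys; apply: contraNneq xs => ->. Qed.

Ltac adj := solve [assumption | rewrite sedge_sym; assumption].
Ltac neq := solve
  [ assumption | rewrite eq_sym; assumption
  | apply: edge_neq; adj
  | eapply notin_neq; eassumption | rewrite eq_sym; eapply notin_neq; eassumption ].
Ltac distinct :=
  rewrite /= ?inE ?negb_or; repeat (apply/andP; split); solve [exact: isT | neq].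
Ltac adjacent :=
  rewrite /=; repeat (apply/andP; split); solve [exact: isT | adj].

Section Caps.
Variable G : sgraph.
Hypotheses (regG : quartic G) (sprG : spreading G).
Implicit Types (x y z : G) (s t P : seq G).

(** A tight part [P] of the graph attached to the rest only through the three
    pairwise non-adjacent ports in [s], each of which has two of its four
    neighbours inside: this is how K5 or the octahedron, each minus a triangle,
    sits in [G]. *)
Record cap P s : Prop := Cap {
  cap_tight : tight P;
  cap_uniq : uniq s;
  cap_size : size s = 3;
  cap_sub : {subset s <= P};
  cap_inner : forall x y, x \in P -> x \notin s -> sedge x y -> y \in P;
  cap_port : forall x, x \in s -> count (sedge x) P = 2;
  cap_indep : forall x y, x \in s -> y \in s -> sedge x y = false }.

Lemma cap_perm P s t : perm_eq s t -> cap P s -> cap P t.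
Proof.
move=> pst [tP us s3 sP inn port indep]; have mem_st := perm_mem pst.
split=> //; first by rewrite -(perm_uniq pst).
- by rewrite -(perm_size pst).
- by move=> x; rewrite -mem_st; apply: sP.
- by move=> x y; rewrite -mem_st; apply: inn.
- by move=> x; rewrite -mem_st; apply: port.
- by move=> x y; rewrite -!mem_st; apply: indep.
Qed.

(** [A] contains what completes the ports [s] to K5 minus a triangle. *)
Definition k5_side (A : pred G) s := exists p q,
  [/\ A p, A q, sedge p q & forall x, x \in s -> sedge x p /\ sedge x q].

(** [A] contains what completes the ports [s] to the octahedron minus a triangle;
    [f x] is the vertex of the inner triangle opposite to the port [x]. *)
Definition octa_side (A : pred G) s := exists f : G -> G,
  (forall x, x \in s -> A (f x)) /\
  forall x y, x \in s -> y \in s -> x != y -> sedge (f x) (f y) /\ sedge x (f y).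

Lemma k5_side_perm A s t : s =i t -> k5_side A s -> k5_side A t.
Proof.
by move=> st [p [q [Ap Aq pq spq]]]; exists p, q; split=> // x; rewrite -st; apply: spq.
Qed.

Lemma octa_side_perm A s t : s =i t -> octa_side A s -> octa_side A t.
Proof.
move=> st [f [Af sf]]; exists f; split=> [x|x y]; first by rewrite -st; apply: Af.
by rewrite -!st; apply: sf.
Qed.

Section OneCap.
Variables (P s : seq G).
Hypothesis capP : cap P s.

Lemma size_outside t :
  uniq t -> {in t, forall x, x \notin P} -> size P + size t <= #|G|.
Proof.
move=> ut tP; have [[uP _ _] _ _ _ _ _ _] := capP.
rewrite -size_cat -(card_uniqP (_ : uniq (P ++ t))) ?max_card // cat_uniq uP ut andbT /=.
by apply/hasPn=> x /tP.
Qed.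

Lemma port_outside x : x \in s -> exists2 z, z \notin P & sedge x z.
Proof.
move=> xs; have lt4 : size [seq y <- P | sedge x y] < 4.
  by rewrite size_filter (cap_port capP).
have [z + xz] := nbrs_more regG x lt4; rewrite mem_filter xz => zP.
by exists z.
Qed.

Lemma outside_port x y : x \in P -> y \notin P -> sedge x y -> x \in s.
Proof.
by move=> xP yP xy; apply: contraNT yP => xs; apply: (cap_inner capP) xy.
Qed.

(** The edge [xz] lies in a triangle, whose third corner cannot be inside [P]
    because ports are independent; so the two outer neighbours of a port are
    adjacent. *)
Lemma port_pair x z : x \in s -> z \notin P -> sedge x z ->
  exists z', [/\ z' \notin P, sedge x z', sedge z z'
    & forall y, y \notin P -> sedge x y -> y \in [:: z; z']].
Proof.
move=> xs zP xz; have [z' z'x z'z] := edge_in_triangle regG sprG xz.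
have z'P : z' \notin P.
  apply/negP=> z'P; have z's := outside_port z'P zP z'z.
  by rewrite (cap_indep capP) in z'x.
rewrite sedge_sym in z'x; rewrite sedge_sym in z'z.
exists z'; split=> // y yP xy; apply/negPn/negP=> yN.
have [[uP _ _] _ _ _ _ _ _] := capP.
have /(_ x) := @size_nbrs _ regG _ ([:: y; z; z'] ++ [seq u <- P | sedge x u]).
rewrite cat_uniq all_cat filter_all filter_uniq // !andbT size_cat size_filter.
rewrite (cap_port capP) //= yN xy xz z'x inE edge_neq // => lt5.
suff: false by []; apply: lt5 => //; apply/hasPn=> u; rewrite mem_filter /=.
case/andP=> _ uP'; apply/negP; rewrite !inE => /or3P[]/eqP e; move: uP'; rewrite e.
- by rewrite (negPf yP).
- by rewrite (negPf zP).
- by rewrite (negPf z'P).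
Qed.

End OneCap.

(** Let [z, z'] and [z, z''] be the outer neighbours of [b] and [c]. If
    [z' = z''], then [z'] sees [b], [c] and [z]; tightness leaves at most three
    vertices outside [P], and the outer neighbours of [d] have to be [z] and [z']:
    K5 minus a triangle. If [z'] and [z''] differ, then the triangle [b z z'] can
    only spread to [z''], so [z'] and [z''] are adjacent; now [z''] sees [c], [z]
    and [z'], at most four vertices are outside [P], and the outer neighbours of
    [d] have to be [z'] and [z'']: the octahedron minus a triangle. *)
Lemma cap_far_side_two_ports P b c d z : cap P [:: b; c; d] ->
    z \notin P -> sedge b z -> sedge c z ->
  k5_side (predC [in P]) [:: b; c; d] \/ octa_side (predC [in P]) [:: b; c; d].
Proof.
move=> capP zP bz cz; have [tP us _ sP inn port indep] := capP.
have [uP _ _] := tP.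
have out := @outside_port _ _ capP.
have [b_s c_s d_s] : [/\ b \in [:: b; c; d], c \in [:: b; c; d] & d \in [:: b; c; d]].
  by rewrite !inE !eqxx !orbT.
have [bP cP dP] := And3 (sP b b_s) (sP c c_s) (sP d d_s).
have /and3P[] := us; rewrite !inE negb_or => /andP[nbc nbd] ncd _.
have [z' [z'P bz' zz' only_b]] := port_pair capP b_s zP bz.
have [z'' [z''P cz'' zz'' only_c]] := port_pair capP c_s zP cz.
have nzz' := edge_neq zz'; have nzz'' := edge_neq zz''.
have tzP : tight (z :: P).
  apply: tight_cons => //; apply: (@count_ge _ _ _ [:: b; c]).
  - by distinct.
  - by move=> x; rewrite !inE => /orP[]/eqP->.
  - by adjacent.
have [y1 y1P dy1] := port_outside capP d_s.
have [y2 [y2P dy2 y12 only_d]] := port_pair capP d_s y1P dy1.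
have [e|ne] := eqVneq z' z''.
  move: cz''; rewrite -{z'' z''P only_c zz'' nzz''}e => cz'.
  have le3 : #|G| <= size P + 3.
    have -> : size P + 3 = size (z :: P) + 2 by rewrite /= addSnnS.
    apply: (tight_third regG sprG tzP (z := z')); first by distinct.
    apply: (@count_ge _ _ _ [:: z; b; c]).
    - by distinct.
    - by move=> x; rewrite !inE => /or3P[]/eqP->; rewrite ?eqxx ?bP ?cP ?orbT.
    - by adjacent.
  (* The two outer neighbours of [d] are adjacent, and [v] is the only
     neighbour of [u] besides the ports. *)
  have joined u v : u \notin P -> v \notin P -> sedge u v -> sedge b u -> sedge c u ->
      sedge d u -> sedge d v.
    move=> uP' vP uv bu cu du.
    have [w [wP dw uw _]] := port_pair capP d_s uP' du.
    suff : w \in [:: b; c; d; v].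
      have neqP x : x \in P -> (w == x) = false by move/(notin_neq wP)/negPf.
      by rewrite !inE (neqP _ bP) (neqP _ cP) (neqP _ dP) => /eqP<-.
    by apply: (nbrs_full regG (x := u)) uw => //; [distinct | adjacent].
  left; exists z, z'; split=> // x.
  suff [dz dz'] : sedge d z /\ sedge d z' by rewrite !inE => /or3P[]/eqP->.
  have [dz|ndz] := boolP (sedge d z); first by split=> //; apply: (joined z).
  have [dz'|ndz'] := boolP (sedge d z').
    by case/negP: ndz; apply: (joined z') => //; adj.
  have y1z : y1 != z by apply: contraNneq ndz => <-.
  have y2z : y2 != z by apply: contraNneq ndz => <-.
  have y1z' : y1 != z' by apply: contraNneq ndz' => <-.
  have y2z' : y2 != z' by apply: contraNneq ndz' => <-.
  have : size P + 4 <= #|G|.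
    apply: (size_outside capP (t := [:: z; z'; y1; y2])).
      by distinct.
    by apply/allP; rewrite /= zP z'P y1P y2P.
  by move=> ge4; have := leq_trans ge4 le3; rewrite leq_add2l.
have Nz x : sedge z x -> x \in [:: b; c; z'; z''].
  by apply: (nbrs_full regG) => //; [distinct | adjacent].
have no_b_c w : w \notin [:: z; z'; z''] -> w \notin P -> ~~ sedge w b /\ ~~ sedge w c.
  rewrite !inE !negb_or => /and3P[wz wz' wz''] wP.
  split; apply/negP; rewrite sedge_sym.
    by move/(only_b _ wP); rewrite !inE (negPf wz) (negPf wz').
  by move/(only_c _ wP); rewrite !inE (negPf wz) (negPf wz'').
have z'z'' : sedge z' z''.
  have [w] := triangle_spreads regG sprG bz bz' zz'.
  rewrite !inE !negb_or => /and3P[wb wz wz'].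
  have b_far v : v \notin P -> sedge b v -> ~ (sedge w b /\ sedge w v).
    move=> vP bv [wb' wv]; have [wP|wP] := boolP (w \in P).
      by have := indep w b (out w v wP vP wv) b_s; rewrite wb'.
    have := only_b w wP; rewrite sedge_sym wb' !inE (negPf wz) (negPf wz').
    by move/(_ isT).
  case=> [/b_far|/b_far|[wz0 wz'0]]; [by case | by case | ].
  have := Nz w; rewrite sedge_sym wz0 !inE (negPf wb) (negPf wz') /=.
  case/(_ isT)/orP=> /eqP ew; rewrite ew in wz'0; last by rewrite sedge_sym.
  by have := only_c z' z'P wz'0; rewrite !inE (negPf ne) orbF eq_sym (negPf nzz').
have le4 : #|G| <= size P + 4.
  have -> : size P + 4 = size (z' :: z :: P) + 2 by rewrite /= !addSnnS.
  apply: (tight_third regG sprG (z := z'')); last first.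
  - apply: (@count_ge _ _ _ [:: z'; z; c]); last by adjacent.
      by distinct.
    by move=> x; rewrite !inE => /or3P[]/eqP->; rewrite ?eqxx ?cP ?orbT.
  - by distinct.
  apply: tight_cons => //; first by distinct.
  apply: (@count_ge _ _ _ [:: z; b]); last by adjacent.
    by distinct.
  by move=> x; rewrite !inE => /orP[]/eqP->; rewrite ?eqxx ?bP ?orbT.
have dz y : sedge d y -> y \notin P -> y != z.
  move=> dy yP; apply/eqP=> e; rewrite e sedge_sym in dy; have := Nz d dy.
  rewrite !inE [d == b]eq_sym [d == c]eq_sym (negPf nbd) (negPf ncd) /=.
  by case/orP=> /eqP e'; rewrite -e' dP in z'P z''P.
(* Any other outer neighbour of [d] would be the fourth outer vertex, with
   only [d], [z'] and [z''] to be adjacent to. *)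
have only_d' y : sedge d y -> y \notin P -> y \in [:: z'; z''].
  move=> dy yP; have yz := dz y dy yP; apply/negPn/negP.
  rewrite !inE negb_or => /andP[yz' yz''].
  have [yb yc] : ~~ sedge y b /\ ~~ sedge y c.
    by apply: no_b_c => //; rewrite !inE !negb_or yz yz' yz''.
  have [x xN yx] := @nbrs_more _ regG y [:: d; z'; z''] isT.
  move: xN; rewrite !inE !negb_or => /and3P[xd xz' xz''].
  have [xP|xP] := boolP (x \in P).
    have := out x y xP yP; rewrite sedge_sym yx !inE (negPf xd) orbF => /(_ isT).
    by case/orP=> /eqP e; [move: yb | move: yc]; rewrite -e yx.
  have [xz|xz] := eqVneq x z.
    rewrite xz sedge_sym in yx; have := Nz y yx; rewrite !inE.
    rewrite (negPf yz') (negPf yz'') !orbF.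
    by case/orP=> /eqP e; move: yP; rewrite e ?bP ?cP.
  have : size P + 5 <= #|G|.
    apply: (size_outside capP (t := [:: z; z'; z''; y; x])); first by distinct.
    by apply/allP; rewrite /= zP z'P z''P yP xP.
  by move=> ge5; have := leq_trans ge5 le4; rewrite leq_add2l.
have [dz' dz''] : sedge d z' /\ sedge d z''.
  move: (only_d' _ dy1 y1P) (only_d' _ dy2 y2P) y12; rewrite !inE.
  case/orP=> /eqP e1 /orP[]/eqP e2; move: dy1 dy2; rewrite e1 e2 ?sedge_irrefl //.
right; exists (fun x => if x == b then z'' else if x == c then z' else z); split.
  by move=> x _ /=; case: ifP => _; [|case: ifP].
move=> x y; rewrite !inE; rewrite eq_sym in nbc.
rewrite eq_sym in nbd; rewrite eq_sym in ncd.
case/or3P=> /eqP-> /or3P[]/eqP->;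
  rewrite ?eqxx ?(negPf nbc) ?(negPf nbd) ?(negPf ncd) //=;
  by move=> _; split; adj.
Qed.

(** The percolation started inside [P] has to leave it through two ports. *)
Lemma cap_far_side P s : cap P s ->
  k5_side (predC [in P]) s \/ octa_side (predC [in P]) s.
Proof.
move=> capP; have [tP us s3 sP inn port indep] := capP.
have [uP [p [q [pP qP pq]]] _] := tP.
have /hasP[b0 b0s _] : has predT s by rewrite has_predT s3.
have [y yP _] := port_outside capP b0s.
have ltP : size P < #|G|.
  rewrite -addn1; apply: (size_outside capP (t := [:: y])) => //.
  by move=> x; rewrite inE => /eqP->.
have [z zP] := spread_seq sprG uP pP qP pq ltP.
rewrite deg_count // => /deg_gt1P[b [c []]]; rewrite !inE.
move=> bP cP nbc; rewrite ![sedge z _]sedge_sym => bz cz.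
have bs := outside_port capP bP zP bz; have cs := outside_port capP cP zP cz.
have [d eqs] : exists d, perm_eq s [:: b; c; d].
  have eqb := perm_to_rem bs.
  have cs' : c \in rem b s by rewrite mem_rem_uniq // !inE eq_sym nbc.
  have eqc := perm_to_rem cs'.
  have : size (rem c (rem b s)) = 1 by rewrite !size_rem // s3.
  case e: (rem c (rem b s)) => [|d []] // _; exists d.
  by apply: (perm_trans eqb); rewrite perm_cons -e.
have mem_s : [:: b; c; d] =i s by move=> x; rewrite (perm_mem eqs).
have [side|side] := cap_far_side_two_ports (cap_perm eqs capP) zP bz cz.
  by left; apply: k5_side_perm side.
by right; apply: octa_side_perm side.
Qed.

End Caps.

(** * Gluing two pieces *)

Section Assembly.
Variable G : sgraph.
Hypotheses (regG : quartic G) (sprG : spreading G).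
Implicit Types (x y z : G) (s t P : seq G).

Definition glue k l (a : 'I_3 -> G) (h : 'I_k -> G) (h' : 'I_l -> G)
    (u : 'I_3 + ('I_k + 'I_l)) : G :=
  match u with inl i => a i | inr (inl j) => h j | inr (inr j) => h' j end.

Definition clique_map k (h : 'I_k -> G) := forall i j, i != j -> sedge (h i) (h j).

Lemma clique_map_inj k (h : 'I_k -> G) : clique_map h -> injective h.
Proof.
move=> clq i j e; apply/eqP/negPn/negP=> /clq; rewrite e.
by rewrite sedge_irrefl.
Qed.

Lemma glue_inj k l (a : 'I_3 -> G) (h : 'I_k -> G) (h' : 'I_l -> G) :
    injective a -> clique_map h -> clique_map h' ->
    (forall i j, a i != h j) -> (forall i j, a i != h' j) ->
    (forall i j, h i != h' j) ->
  injective (glue a h h').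
Proof.
move=> inj_a /clique_map_inj inj_h /clique_map_inj inj_h' ah ah' hh'.
case=> [i|[i|i]] [j|[j|j]] //= => [/inj_a->|e|e|e|/inj_h->|e|e|e|/inj_h'->] //.
- by have := ah i j; rewrite e eqxx.
- by have := ah' i j; rewrite e eqxx.
- by have := ah j i; rewrite e eqxx.
- by have := hh' i j; rewrite e eqxx.
- by have := ah' j i; rewrite e eqxx.
- by have := hh' j i; rewrite e eqxx.
Qed.

Section Sides.
Variables (A : pred G) (s : seq G) (x0 : G).
Hypotheses (s3 : size s = 3) (us : uniq s).
Local Notation a := (fun i : 'I_3 => nth x0 s i).

Lemma k5_side_map : k5_side A s -> exists h : 'I_2 -> G,
  [/\ forall j, A (h j), clique_map h & forall i j, sedge (a i) (h j)].
Proof.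
case=> p [q [Ap Aq pq spq]]; exists (fun j => if j == ord0 then p else q); split.
- by move=> j; case: ifP.
- case=> [[|[|]] //] ? [[|[|]] //] ? //= _; by rewrite // sedge_sym.
by move=> i j; have [|? ?] := spq (nth x0 s i); [rewrite mem_nth ?s3 | case: ifP].
Qed.

Lemma octa_side_map : octa_side A s -> exists h : 'I_3 -> G,
  [/\ forall j, A (h j), clique_map h & forall i j, i != j -> sedge (a i) (h j)].
Proof.
case=> f [Af sf]; exists (f \o a).
have a_s i : a i \in s by rewrite mem_nth ?s3.
have na i j : i != j -> a i != a j by rewrite nth_uniq ?s3.
split=> [j|i j /na ij|i j /na ij]; first exact: Af.
  by have [] := sf _ _ (a_s i) (a_s j) ij.
by have [] := sf _ _ (a_s i) (a_s j) ij.
Qed.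

End Sides.

(** The near and the far side of the ports are each K5 or the octahedron minus a
    triangle; the four combinations give the three graphs. *)
Lemma cap_classification P s : cap P s ->
    k5_side [in P] s \/ octa_side [in P] s ->
  [\/ iso G Q1, iso G Q2 | iso G Q3].
Proof.
move=> capP near; have far := cap_far_side regG sprG capP.
have [tP us s3 sP inn port indep] := capP.
have /hasP[x0 _ _] : has predT s by rewrite has_predT s3.
pose a (i : 'I_3) := nth x0 s i.
have a_s i : a i \in s by rewrite mem_nth ?s3.
have inj_a : injective a.
  by move=> i j /eqP; rewrite nth_uniq ?s3 // => /eqP/val_inj.
have near_neq i j h : sedge (a j) h -> a i != h.
  by move=> ah; apply/eqP=> e; move: ah; rewrite -e indep.
have far_neq x h : x \in P -> predC [in P] h -> x != h.
  by move=> xP hP; rewrite eq_sym; apply: notin_neq hP xP.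
have other (j : 'I_3) : exists i : 'I_3, i != j.
  by exists (ordS j); case: j => [[|[|[|]]]].
have Q_gt0 k l : 0 < #|{: 'I_3 + ('I_k + 'I_l)}| by rewrite !card_sum card_ord.
case: near => [/(k5_side_map x0 s3)[h [hP clq_h ah]]|
               /(octa_side_map x0 s3 us)[h [hP clq_h ah]]];
case: far => [/(k5_side_map x0 s3)[h' [h'P clq_h' ah']]|
              /(octa_side_map x0 s3 us)[h' [h'P clq_h' ah']]].
- constructor 1; apply: (iso_of_injective_hom (g := glue a h h' : Q1 -> G)) => //.
  + exact: Q_gt0.
  + exact: Q1_quartic.
  + apply: glue_inj => // i j; last exact: far_neq (hP i) (h'P j).
      exact: near_neq (ah ord0 j).
    exact: far_neq (sP _ (a_s i)) (h'P j).
  case=> [i|[i|i]] [j|[j|j]] //= => [_|_|_|/clq_h|_|/clq_h'] //.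
  + exact: ah.
  + exact: ah'.
  + by rewrite sedge_sym; apply: ah.
  by rewrite sedge_sym; apply: ah'.
- constructor 3; apply: (iso_of_injective_hom (g := glue a h h' : Q3 -> G)) => //.
  + exact: Q_gt0.
  + exact: Q3_quartic.
  + apply: glue_inj => // i j; last exact: far_neq (hP i) (h'P j).
      exact: near_neq (ah ord0 j).
    exact: far_neq (sP _ (a_s i)) (h'P j).
  case=> [i|[i|i]] [j|[j|j]] //= => [_|/ah'|_|/clq_h|ij|/clq_h'] //.
  + exact: ah.
  + by rewrite sedge_sym; apply: ah.
  by rewrite sedge_sym; apply: ah'; rewrite eq_sym.
- constructor 3; apply: (iso_of_injective_hom (g := glue a h' h : Q3 -> G)) => //.
  + exact: Q_gt0.
  + exact: Q3_quartic.
  + apply: glue_inj => // i j; last by rewrite eq_sym; exact: far_neq (hP j) (h'P i).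
      exact: far_neq (sP _ (a_s i)) (h'P j).
    have [i' /ah] := other j; exact: near_neq.
  case=> [i|[i|i]] [j|[j|j]] //= => [_|/ah|_|/clq_h'|ij|/clq_h] //.
  + exact: ah'.
  + by rewrite sedge_sym; apply: ah'.
  by rewrite sedge_sym; apply: ah; rewrite eq_sym.
- constructor 2; apply: (iso_of_injective_hom (g := glue a h h' : Q2 -> G)) => //.
  + exact: Q_gt0.
  + exact: Q2_quartic.
  + apply: glue_inj => // i j; last exact: far_neq (hP i) (h'P j).
      have [i' /ah] := other j; exact: near_neq.
    exact: far_neq (sP _ (a_s i)) (h'P j).
  case=> [i|[i|i]] [j|[j|j]] //= => [/ah|/ah'|ij|/clq_h|ij|/clq_h'] //.
  + by rewrite sedge_sym; apply: ah; rewrite eq_sym.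
  by rewrite sedge_sym; apply: ah'; rewrite eq_sym.
Qed.

End Assembly.

(** * Finding a piece *)

Ltac nonadj := solve
  [ exact: sedge_irrefl | assumption | rewrite sedge_sym; assumption
  | apply/negbTE; assumption | rewrite sedge_sym; apply/negbTE; assumption ].
Ltac edge_values := repeat match goal with |- context [sedge ?x ?y] =>
  first [ rewrite (_ : sedge x y = true); [|adj]
        | rewrite (_ : sedge x y = false); [|nonadj] ] end.

Section Diamonds.
Variable G : sgraph.
Hypotheses (regG : quartic G) (sprG : spreading G).
Implicit Types (a b c d e p q r s t u v w x y z : G).

(** The first three vertices form a tight list of size 3. *)
Lemma no_K4 x y z w : 6 <= #|G| -> sedge x y -> sedge x z -> sedge y z ->
  sedge w x -> sedge w y -> sedge w z = false.
Proof.
move=> ge6 xy xz yz wx wy; apply/negbTE/negP=> wz.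
suff le5 : #|G| <= 5 by have := leq_trans ge6 le5.
apply: (tight_third regG sprG (z := w) (s := [:: z; x; y])).
- apply: tight_cons; [exact: tight_edge | by distinct |].
  by rewrite /=; edge_values.
- by distinct.
by rewrite /=; edge_values.
Qed.

(** Two triangles sharing an edge form a tight list of size 4. *)
Lemma diamond_third p q r s w : sedge p q -> sedge r p -> sedge r q ->
    sedge s p -> sedge s q -> r != s -> w != q ->
  sedge w p -> sedge w r -> sedge w s -> #|G| <= 6.
Proof.
move=> pq rp rq sp sq nrs nwq wp wr ws.
apply: (tight_third regG sprG (z := w) (s := [:: s; r; p; q])).
- apply: tight_cons; [| by distinct |].
    apply: tight_cons; [exact: tight_edge | by distinct |].
    by rewrite /=; edge_values.
  by rewrite /= sp sq; case: sedge.
- by distinct.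
by rewrite /= wp wr ws; case: sedge.
Qed.

Definition capped := exists P S : seq G,
  cap P S /\ (k5_side [in P] S \/ octa_side [in P] S).

Lemma k5_capped p q r s t : 6 <= #|G| -> sedge p q -> uniq [:: r; s; t] ->
    sedge r p -> sedge r q -> sedge s p -> sedge s q -> sedge t p -> sedge t q ->
  capped.
Proof.
move=> ge6 pq /=; rewrite !inE negb_or => /and3P[/andP[nrs nrt] nst _] rp rq sp sq tp tq.
have indep x y : sedge x p -> sedge x q -> sedge y p -> sedge y q -> sedge x y = false.
  by move=> xp xq yp yq; apply: (no_K4 (x := p) (y := q)) => //; adj.
have rs := indep _ _ rp rq sp sq; have rt := indep _ _ rp rq tp tq.
have st := indep _ _ sp sq tp tq.
exists [:: t; s; r; p; q], [:: r; s; t]; split; last first.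
  left; exists p, q; split; rewrite ?inE ?eqxx ?orbT //.
  by move=> x; rewrite !inE => /or3P[]/eqP->.
split=> //.
- do 3![apply: tight_cons; [ | by distinct | by rewrite /=; edge_values]].
  exact: tight_edge.
- by distinct.
- by move=> x; rewrite !inE => /or3P[]/eqP->; rewrite eqxx ?orbT.
- move=> x y; rewrite !inE => /or4P[| | |/orP[]] /eqP->; rewrite ?eqxx ?orbT //.
    move=> _ py; suff: y \in [:: t; s; r; q] by rewrite !inE => /or4P[]->; rewrite ?orbT.
    by apply: (nbrs_full regG) py => //; [distinct | adjacent].
  move=> _ qy; suff: y \in [:: t; s; r; p] by rewrite !inE => /or4P[]->; rewrite ?orbT.
  by apply: (nbrs_full regG) qy => //; [distinct | adjacent].
- by move=> x; rewrite !inE => /or3P[]/eqP->; rewrite /=; edge_values.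
by move=> x y; rewrite !inE => /or3P[]/eqP-> /or3P[]/eqP->; nonadj.
Qed.

Lemma octa_capped b c d a e u : sedge b c -> sedge c d -> sedge b d ->
    sedge a b -> sedge a c -> sedge e c -> sedge e d -> sedge u b -> sedge u d ->
    uniq [:: a; e; u] -> sedge a e = false -> sedge a u = false -> sedge e u = false ->
  capped.
Proof.
move=> bc cd bd ab ac ec ed ub ud /=; rewrite !inE negb_or.
case/and3P=> /andP[nae nau] neu _ ae au eu.
have neq_of x y z : sedge x z = false -> sedge y z -> x != y.
  by move=> xz yz; apply: contraFneq xz => ->.
have nad : a != d by apply: (neq_of _ _ u) => //; adj.
have neb : e != b by apply: (neq_of _ _ a); [nonadj | adj].
have nuc : u != c by apply: (neq_of _ _ a); [nonadj | adj].
have nb y : sedge b y -> y \in [:: c; d; a; u].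
  by apply: (nbrs_full regG) => //; [distinct | adjacent].
have nc y : sedge c y -> y \in [:: b; d; a; e].
  by apply: (nbrs_full regG) => //; [distinct | adjacent].
have nd y : sedge d y -> y \in [:: b; c; e; u].
  by apply: (nbrs_full regG) => //; [distinct | adjacent].
have be : sedge b e = false by apply/negbTE; apply: contra (nb e) _; distinct.
have cu : sedge c u = false by apply/negbTE; apply: contra (nc u) _; distinct.
have da : sedge d a = false by apply/negbTE; apply: contra (nd a) _; distinct.
exists [:: u; e; a; d; b; c], [:: a; e; u]; split; last first.
  right; exists (fun x => if x == a then d else if x == e then b else c); split.
    by move=> x _ /=; case: ifP => _; [|case: ifP => _]; rewrite !inE eqxx ?orbT.
  rewrite eq_sym in nae; rewrite eq_sym in nau; rewrite eq_sym in neu.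
  move=> x y; rewrite !inE.
  by case/or3P=> /eqP-> /or3P[]/eqP->;
    rewrite ?eqxx ?(negPf nae) ?(negPf nau) ?(negPf neu) //=;
    move=> _; split; adj.
split=> //.
- do 4![apply: tight_cons; [ | by distinct | by rewrite /=; edge_values]].
  exact: tight_edge.
- by distinct.
- by move=> x; rewrite !inE => /or3P[]/eqP->; rewrite eqxx ?orbT.
- move=> x y; rewrite !inE => /or4P[| | |/or3P[]] /eqP->; rewrite ?eqxx ?orbT // => _.
  + by move/nd; rewrite !inE => /or4P[]->; rewrite ?orbT.
  + by move/nb; rewrite !inE => /or4P[]->; rewrite ?orbT.
  + by move/nc; rewrite !inE => /or4P[]->; rewrite ?orbT.
- by move=> x; rewrite !inE => /or3P[]/eqP->; rewrite /=; edge_values.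
by move=> x y; rewrite !inE => /or3P[]/eqP-> /or3P[]/eqP->; nonadj.
Qed.

End Diamonds.

(** * Squared paths *)

Section SquaredPaths.
Variable G : sgraph.
Hypotheses (regG : quartic G) (sprG : spreading G).
Implicit Types (a b c d e p q r u v w x y z : G) (s t : seq G).

(** Copies of squares of paths, not necessarily induced. *)
Fixpoint sqpath s := 
  if s is x :: s' then [&& x \notin s', all (sedge x) (take 2 s') & sqpath s']
  else true.

Lemma sqpath_uniq s : sqpath s -> uniq s.
Proof. by elim: s => //= x s IHs /and3P[-> _ /IHs]. Qed.

Lemma sqpath_nth x0 s i j : sqpath s -> i < j < size s -> j <= i + 2 ->
  sedge (nth x0 s i) (nth x0 s j).
Proof.
elim: s i j => [|x s IHs] i j /=; first by rewrite ltn0 andbF.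
case/and3P=> _ xs sqs; case: i j => [|i] [|j] // lt_ij le_j; last exact: IHs.
have lt2 : j < 2 by [].
rewrite /= -(nth_take x0 lt2); apply: (allP xs); apply: mem_nth.
by case/andP: lt_ij => _ lt_j; rewrite size_take_min leq_min lt2 /=; exact: lt_j.
Qed.

Lemma sqpath_prefix s t : sqpath (s ++ t) -> sqpath s.
Proof.
elim: s => //= x s IHs /and3P[+ xs /IHs->]; rewrite mem_cat negb_or => /andP[-> _].
by case: s xs {IHs} => [|y [|z s]] //=; rewrite ?take0 andbT // => /andP[->].
Qed.

Lemma iso_cycle_square s x0 : 5 <= size s -> uniq s ->
    (forall i, i < size s -> sedge (nth x0 s i) (nth x0 s (i.+1 %% size s))) ->
    (forall i, i < size s -> sedge (nth x0 s i) (nth x0 s (i.+2 %% size s))) ->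
  iso G (square (cycle_graph (size s))).
Proof.
move=> ge5 us edge1 edge2.
pose g (i : square (cycle_graph (size s))) : G := nth x0 s (val (i : 'I_(size s))).
have inj_g (i j : 'I_(size s)) : g i = g j -> i = j.
  by move/eqP; rewrite nth_uniq ?ltn_ord // => /eqP/val_inj.
apply: (iso_of_injective_hom (g := g)) => //.
- by rewrite card_ord (leq_trans _ ge5).
- exact: cycle_square_quartic.
have hom1 (i : 'I_(size s)) : sedge (g i) (g (ordS i)) := edge1 _ (ltn_ord i).
have hom2 (i : 'I_(size s)) : sedge (g i) (g (ordS (ordS i))).
  rewrite /g /= -[(_ %% _).+1]addn1 modnDml addn1; exact: edge2 (ltn_ord i).
move=> i j; rewrite cycle_square_edge // => /or4P[]/eqP->; rewrite ?hom1 ?hom2 //;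
  by rewrite sedge_sym ?hom1 ?hom2.
Qed.

Hypotheses (ge6 : 6 <= #|G|) (uncapped : ~ capped G).

(** The fourth neighbour [u] of [p] is not adjacent to [q], since otherwise [p]
    and [q] would have three common neighbours and span K5 minus a triangle with
    them. So a triangle on [pu] has its third corner at [r] or [v]. *)
Lemma diamond_sqpath p q r v : sedge p q -> sedge r p -> sedge r q ->
    sedge v p -> sedge v q -> r != v ->
  exists2 s, sqpath s & size s = 5.
Proof.
move=> pq rp rq vp vq nrv.
have [u + pu] := @nbrs_more _ regG p [:: q; r; v] isT.
rewrite !inE !negb_or => /and3P[uq ur uv].
have nuq : sedge u q = false.
  apply/negP=> uq'; apply: uncapped.
  apply: (k5_capped regG sprG ge6 pq (r := r) (s := v) (t := u)) => //.
    by distinct.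
  by adj.
have [w wp wu] := edge_in_triangle regG sprG pu.
have : w \in [:: q; r; v; u].
  by apply: (nbrs_full regG (x := p)) => //; [distinct | adjacent | adj].
rewrite !inE => /or4P[] /eqP e; move: wu; rewrite e ?sedge_irrefl //.
- by rewrite sedge_sym nuq.
- by move=> ru; exists [:: v; q; p; r; u] => //; rewrite /sqpath /= !andbT;
    repeat (apply/andP; split); solve [distinct | adj].
- by move=> vu; exists [:: r; q; p; v; u] => //; rewrite /sqpath /= !andbT;
    repeat (apply/andP; split); solve [distinct | adj].
Qed.

Lemma exists_sqpath : exists2 t, sqpath t & size t = 5.
Proof.
have /card_gt0P[x _] : 0 < #|G| by apply: leq_trans ge6.
have /deg_gt0P[y _ xy] : 0 < deg setT x by rewrite regG.
have [z zx zy] := edge_in_triangle regG sprG xy.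
have [||w] := triangle_spreads regG sprG xy (z := z); try adj.
rewrite !inE !negb_or => /and3P[wx wy wz].
case=> [[wx' wy']|[wx' wz']|[wy' wz']].
- by apply: (@diamond_sqpath x y z w) => //; neq.
- by apply: (@diamond_sqpath x z y w) => //; solve [neq | adj].
by apply: (@diamond_sqpath y z x w) => //; solve [neq | adj].
Qed.

(** Let [u] be the fourth neighbour of [d]. It differs from [a], since otherwise
    [c] and [d] would have three common neighbours. A triangle on [d u] has its third
    corner at [b] or [e], as [c] has no neighbour left. If [u] were not adjacent
    to [e], then it would be adjacent to [b], and [b c d] would be the inner
    triangle of an octahedron minus the triangle [a e u]. *)
Lemma sqpath_extend a b c d e t : sqpath [:: e, d, c, b, a & t] ->
  exists u, [/\ u \notin [:: e; d; c; b; a], sedge u e & sedge u d].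
Proof.
move=> sqs; have us := sqpath_uniq sqs.
have nth_edge i j := @sqpath_nth e _ i j sqs.
have ed : sedge e d := nth_edge 0 1 isT isT.
have ec : sedge e c := nth_edge 0 2 isT isT.
have dc : sedge d c := nth_edge 1 2 isT isT.
have db : sedge d b := nth_edge 1 3 isT isT.
have cb : sedge c b := nth_edge 2 3 isT isT.
have ca : sedge c a := nth_edge 2 4 isT isT.
have ba : sedge b a := nth_edge 3 4 isT isT.
have {us} us : uniq [:: e; d; c; b; a].
  move: us; rewrite -[[:: e, d, c, b, a & t]]/([:: e; d; c; b; a] ++ t) cat_uniq.
  by case/andP.
move: us; rewrite /= !inE !negb_or.
case/and5P=> /and4P[_ _ neb nea] /and3P[_ _ nda] _ _ _.
have [u + du] := @nbrs_more _ regG d [:: b; c; e] isT.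
rewrite !inE !negb_or => /and3P[nub nuc nue].
have nua : u != a.
  apply/eqP=> eua; apply: uncapped; rewrite eua in du.
  by apply: (k5_capped regG sprG ge6 dc (r := e) (s := b) (t := a)) => //;
    solve [distinct | adj].
have nc y : sedge c y -> y \in [:: e; d; b; a].
  by apply: (nbrs_full regG) => //; [distinct | adjacent].
have cu : sedge c u = false by apply/negbTE; apply: contra (nc u) _; distinct.
have uNs : u \notin [:: e; d; c; b; a] by distinct.
exists u; split=> //; last by adj.
apply/negPn/negP=> nue'; have ue : sedge u e = false by apply/negbTE.
have [w wd wu] := edge_in_triangle regG sprG du.
have bu : sedge b u.
  have : w \in [:: b; c; e; u].
    by apply: (nbrs_full regG (x := d)) => //; [distinct | adjacent | adj].
  rewrite !inE => /or4P[] /eqP ew; move: wu; rewrite ew ?cu ?sedge_irrefl //.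
  by rewrite sedge_sym ue.
have gt6 : 6 < #|G|.
  pose T := [set:: [:: u; c; e]].
  have cardT : #|T| = 3 by rewrite cardsE (card_uniqP _) //; distinct.
  have : deg setT u <= #|~: T|.
    apply: subset_leq_card; apply/subsetP=> y; rewrite !inE /=.
    by apply: contraL => /or3P[]/eqP->; edge_values.
  by rewrite regG -(cardsC T) cardT -(leq_add2l 3).
have nonedge p q x y z : sedge p q -> sedge x p -> sedge x q -> sedge y p -> sedge y q ->
    x != y -> z != q -> sedge z p -> sedge z x -> sedge z y = false.
  move=> pq xp xq yp yq nxy nzq zp zx; apply/negbTE/negP=> zy.
  have := diamond_third regG sprG pq xp xq yp yq nxy nzq zp zx zy.
  by rewrite leqNgt gt6.
have ae : sedge a e = false by apply: (nonedge c d b e) => //; solve [neq | adj].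
have au : sedge a u = false by apply: (nonedge b d c u) => //; solve [neq | adj].
apply: uncapped.
apply: (octa_capped regG (b := b) (c := c) (d := d) (a := a) (e := e) (u := u));
  solve [nonadj | adj | distinct].
Qed.

(** The vertex given by [sqpath_extend] already lies on the path; if it were not
    the last one, it would have five neighbours. *)
Lemma max_sqpath_last s x0 : sqpath s -> 5 <= size s ->
    (forall t, sqpath t -> size t <= size s) ->
  [/\ 6 <= size s, sedge (last x0 s) (nth x0 s 0) & sedge (last x0 s) (nth x0 s 1)].
Proof.
move=> sqs ge5 max_s.
case eqs: s => [|e [|d [|c [|b [|a r]]]]]; rewrite eqs // in ge5.
rewrite -eqs; have sqs' := sqs; rewrite eqs in sqs'.
have [u [uN ue ud]] := sqpath_extend sqs'.
have us : u \in s.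
  apply/negPn/negP=> uNs; suff /max_s : sqpath (u :: s) by rewrite /= ltnn.
  by rewrite /= uNs sqs eqs /= ue ud.
have uniq_s := sqpath_uniq sqs.
pose j := index u s; have lt_j : j < size s by rewrite index_mem.
have uj : nth x0 s j = u by apply: nth_index.
have ge_j : 5 <= j.
  rewrite /j eqs leqNgt; apply: contra uN.
  rewrite -[[:: e, d, c, b, a & r]]/([:: e; d; c; b; a] ++ r) index_cat.
  by case: ifP => //= _; rewrite ltnNge leq_addr.
clearbody j; have s0 : nth x0 s 0 = e by rewrite eqs.
have s1 : nth x0 s 1 = d by rewrite eqs.
have [lt_j1|ge_j1] := ltnP j.+1 (size s); last first.
  have -> : last x0 s = u by rewrite -uj -nth_last; congr nth; lia.
  by rewrite s0 s1; split=> //; lia.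
have lt_i i : i \in [:: j - 2; j - 1; j.+1; 0; 1] -> i < size s.
  by rewrite !inE => /or4P[/eqP->|/eqP->|/eqP->|/orP[]/eqP->]; lia.
(* Three neighbours along the path and the first two vertices. *)
pose t := [seq nth x0 s i | i <- [:: j - 2; j - 1; j.+1; 0; 1]].
suff: size t <= 4 by [].
apply: (size_nbrs regG (x := u)).
  rewrite map_inj_in_uniq /= ?inE; first by lia.
  by move=> i k /lt_i lt_is /lt_i lt_ks /eqP; rewrite nth_uniq // => /eqP.
apply/allP=> v /mapP[i]; rewrite !inE => Hi ->; rewrite -uj.
case/or4P: Hi => [/eqP->|/eqP->|/eqP->|/orP[]/eqP->]; rewrite ?s0 ?s1 ?uj //.
- by rewrite -uj sedge_sym; apply: sqpath_nth => //; lia.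
- by rewrite -uj sedge_sym; apply: sqpath_nth => //; lia.
by rewrite -uj; apply: sqpath_nth => //; lia.
Qed.

(** Moving the last vertex to the front gives another longest squared path, and
    its closing edges supply the adjacency missing around the turn. *)
Lemma max_sqpath_closes s x0 : sqpath s -> 5 <= size s ->
    (forall t, sqpath t -> size t <= size s) ->
  iso G (square (cycle_graph (size s))).
Proof.
move=> sqs ge5 max_s; have [gt5 last0 last1] := max_sqpath_last x0 sqs ge5 max_s.
have [t [l eqs]] : exists t l, s = rcons t l.
  by case/lastP: s ge5 {sqs max_s gt5 last0 last1} => [//|t l] _; exists t, l.
have size_s : size s = (size t).+1 by rewrite eqs size_rcons.
have nth_t i : i < size t -> nth x0 s i = nth x0 t i.
  by move=> lt_i; rewrite eqs nth_rcons lt_i.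
have last_l : last x0 s = l by rewrite eqs last_rcons.
have gt1 : 1 < size t by lia.
have sq_rot : sqpath (l :: t).
  rewrite /=; apply/and3P; split.
  - by have := sqpath_uniq sqs; rewrite eqs rcons_uniq => /andP[].
  - rewrite last_l !nth_t // in last0 last1; last by lia.
    by case: (t) gt1 last0 last1 => [|x [|y t']] //= _ -> ->; rewrite take0.
  by apply: (@sqpath_prefix t [:: l]); rewrite cats1 -eqs.
have [||_ _ turn] := max_sqpath_last x0 sq_rot; rewrite /= -?size_s //.
have last_t : last x0 (l :: t) = nth x0 s (size t).-1.
  by rewrite nth_t ?nth_last; [case: (t) gt1 | lia].
rewrite last_t /= -nth_t in turn; last by lia.
rewrite -nth_last in last0 last1.
apply: (iso_cycle_square (x0 := x0)) => //; first exact: sqpath_uniq.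
  move=> i lt_i; have [lt_i1|ge_i1] := ltnP i.+1 (size s).
    by rewrite modn_small //; apply: sqpath_nth => //; lia.
  have -> : i = (size s).-1 by lia.
  by rewrite prednK ?modnn //; lia.
move=> i lt_i; have [lt_i2|ge_i2] := ltnP i.+2 (size s).
  by rewrite modn_small //; apply: sqpath_nth => //; lia.
have [eqi|eqi] : i = (size t).-1 \/ i = size t by lia.
  have -> : i.+2 = size s by lia.
  by rewrite modnn eqi.
have -> : i.+2 = 1 + size s by lia.
by rewrite modnDr modn_small ?eqi; [rewrite size_s in last1 | lia].
Qed.

Lemma uncapped_cycle_square : exists2 n, 5 <= n & iso G (square (cycle_graph n)).
Proof.
have [t0 sqt0 t0_5] := exists_sqpath.
pose has_sq k := [exists t : k.-tuple G, sqpath t].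
have has_sqP t : sqpath t -> has_sq (size t).
  by move=> sqt; apply/existsP; exists (in_tuple t).
have ex_sq : exists k, has_sq k by exists (size t0); apply: has_sqP.
have le_sq k : has_sq k -> k <= #|G|.
  case/existsP=> t /sqpath_uniq/card_uniqP; rewrite size_tuple => <-.
  exact: max_card.
case: (ex_maxnP ex_sq le_sq) => k /existsP[s sqs] max_k.
have size_s := size_tuple s.
have max_s t : sqpath t -> size t <= size s by rewrite size_s => /has_sqP/max_k.
have ge5 : 5 <= size s by rewrite -t0_5; apply: max_s.
have [x0 _] := card_gt0P (leq_trans (isT : 0 < 6) ge6).
by exists (size s) => //; apply: (max_sqpath_closes x0).
Qed.

End SquaredPaths.

(** * The classification *)

Section Classification.
Variable G : sgraph.
Hypotheses (regG : quartic G) (sprG : spreading G).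

(** A 4-regular graph on five vertices is complete. *)
Lemma order5_cycle_square : #|G| = 5 -> iso G (square (cycle_graph 5)).
Proof.
move=> n5; have size5 : size (enum G) = 5 by rewrite -cardE.
have /card_gt0P[x0 _] : 0 < #|G| by rewrite n5.
have complete (x y : G) : x != y -> sedge x y.
  move=> nxy; apply/negPn/negP=> xy.
  have : deg setT x <= #|~: [set x; y]|.
    apply: subset_leq_card; apply/subsetP=> z; rewrite !inE /= => xz.
    rewrite negb_or eq_sym (edge_neq xz); apply: contraNneq xy => <-.
    exact: xz.
  by rewrite regG; have := cardsC [set x; y]; rewrite cards2 nxy n5; lia.
rewrite -size5; apply: (iso_cycle_square regG sprG (x0 := x0));
  rewrite ?size5 ?enum_uniq //.
  move=> i lt_i; apply: complete; rewrite nth_uniq ?enum_uniq ?size5 ?ltn_pmod //.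
  by do 5![case: i lt_i => [|i] lt_i //].
move=> i lt_i; apply: complete; rewrite nth_uniq ?enum_uniq ?size5 ?ltn_pmod //.
by do 5![case: i lt_i => [|i] lt_i //].
Qed.

Lemma quartic_spreading_classification : 0 < #|G| ->
  [\/ iso G Q1, iso G Q2, iso G Q3
    | exists2 n : nat, 5 <= n & iso G (square (cycle_graph n))].
Proof.
case/card_gt0P=> x0 _; have := order_ge5 regG x0.
rewrite leq_eqVlt => /predU1P[/esym n5|ge6].
  by constructor 4; exists 5 => //; apply: order5_cycle_square.
have [[P [S [capP near]]]|uncapped] := classic (capped G).
  have [] := cap_classification regG sprG capP near;
    by [constructor 1 | constructor 2 | constructor 3].
by constructor 4; apply: uncapped_cycle_square.
Qed.

End Classification.

Theorem theorem15 (G : sgraph) :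
  double_col_critical G /\ col G = 5 <->
  [\/ iso G Q1, iso G Q2, iso G Q3
    | exists2 n : nat, 5 <= n & iso G (square (cycle_graph n))].
Proof.
split=> [[crit col5]|isoG].
  have regG := critical_quartic crit col5.
  have sprG := critical_spreading crit col5.
  apply: quartic_spreading_classification => //.
  rewrite lt0n; apply/eqP=> G0; suff : col G <= 0 by rewrite col5.
  apply/col_le_degenerate=> S _ /set0Pn[x _].
  by have := max_card (pred1 x); rewrite card1 G0.
have Q_gt0 k l : 0 < #|{: 'I_3 + ('I_k + 'I_l)}| by rewrite !card_sum card_ord.
suff [G_gt0 regG sprG] : [/\ 0 < #|G|, quartic G & spreading G].
  exact: critical_of_spreading.
case: isoG => [iso1|iso2|iso3|[n n_ge5 isoC]].
- exact: (iso_transport iso1 (Q_gt0 2 2) Q1_quartic Q1_spreading).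
- exact: (iso_transport iso2 (Q_gt0 3 3) Q2_quartic Q2_spreading).
- exact: (iso_transport iso3 (Q_gt0 2 3) Q3_quartic Q3_spreading).
apply: (iso_transport isoC _ (cycle_square_quartic n_ge5) (cycle_square_spreading n_ge5)).
by rewrite card_ord; apply: leq_trans n_ge5.
Qed.
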